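(* Let $(Z,J,\omega)$ be a compact connected Kähler manifold with a Hamiltonian action by Kähler isometries of a compact connected Lie subgroup $U\subset \mathrm{U}(n)$, and let $\mu:Z\to\mathfrak{u}^*$ be an $\mathrm{Ad}_U^*$-equivariant momentum map. Let $G\subseteq U^{\mathbb C}$ be a real reductive (i.e. real compatible) subgroup with Cartan decomposition $G=K\exp(\mathfrak{p})$, $\mathfrak{g}=\mathfrak{k}\oplus\mathfrak{p}$, and let $\mu_{\mathfrak p}:Z\to\mathfrak p$ be the gradient map associated with $\mu$. Let $f:\mathfrak p\to\mathbb R$ be an $\mathrm{Ad}_K$-invariant, strictly convex function. Suppose that $z\in Z$ is a critical point of $f\circ\mu_{\mathfrak p}:Z\to\mathbb R$, and that $f$ admits a strictly convex, $\mathrm{Ad}_U$-invariant extension $F:i\mathfrak u\to\mathbb R$ (so $F|_{\mathfrak p}=f$) which is $(\mathfrak k,\mathfrak p)$-compatible at $\mu_{\mathfrak p}(z)$. Then the Lie algebra $\mathfrak g_z=\{\xi\in\mathfrak g : \xi_Z(z)=0\}$ has the direct sum decomposition $$\mathfrak g_z=\bigoplus_{\lambda\ge 0}\mathfrak g_\lambda,\qquad \mathfrak g_\lambda:=\{\xi\in\mathfrak g_z : \mathrm{ad}_{(\nabla f)_{\mu_{\mathfrak p}(z)}}\xi=\lambda\xi\}\quad(\lambda\in\mathbb R),$$ and $\mathfrak g_0=\mathfrak k_z\oplus\mathfrak p_z$, where $\mathfrak k_z=\mathfrak g_z\cap\mathfrak k$ and $\mathfrak p_z=\mathfrak g_z\cap\mathfrak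 p$.
   Context: Setting. $(Z,J,\omega)$ is a compact connected Kähler manifold with complex structure $J$, symplectic form $\omega$ and Riemannian metric $Q(\cdot,\cdot)=\omega(\cdot,J\cdot)$. $U\subset\mathrm U(n)$ is a compact connected Lie subgroup with Lie algebra $\mathfrak u$, acting on $Z$ by Kähler isometries (preserving $J$, $\omega$, $Q$). Its complexification is $U^{\mathbb C}=\{\exp(i\eta)u : u\in U,\ \eta\in\mathfrak u\}\subseteq \mathrm{Gl}(n,\mathbb C)$, with Lie algebra $\mathfrak u^{\mathbb C}=\mathfrak u\oplus i\mathfrak u$; since $Z$ is compact the $U$-action extends to a holomorphic action of $U^{\mathbb C}$ on $Z$. For $\xi\in\mathfrak u^{\mathbb C}$, $\xi_Z(z)=\frac{d}{dt}\exp(t\xi).z|_{t=0}$, and $\mathrm{ad}_\xi\eta=[\xi,\eta]$. A momentum map is a map $\mu:Z\to\mathfrak u^*$ satisfying $\langle (d\mu)_z(v)|\xi\rangle=\omega_z(v,\xi_Z(z))$ for all $z\in Z$, $v\in T_zZ$, $\xi\in\mathfrak u$ (with $\langle\cdot|\cdot\rangle$ the canonical pairing), and it is $\mathrm{Ad}_U^*$-equivariant: $\mu(u.z)=\mathrm{Ad}_u^*\mu(z)$, where $\langle\mathrm{Ad}_u^*\alpha|\xi\rangle=\langle\alpha|\mathrm{Ad}_{u^{-1}}\xi\rangle$. The action is Hamiltonian if such a $\mu$ exists. A real compatible (= real reductive) subgroup $G\subseteq U^{\mathbb C}$ is a closed real subgroup with Lie algebra $\mathfrak g$ such that, with $K:=G\cap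 U$ (compact), $\mathfrak k:=\mathrm{Lie}(K)$ and $\mathfrak p:=\mathfrak g\cap i\mathfrak u$, one has $G=K\exp(\mathfrak p)$ and $\mathfrak g=\mathfrak k\oplus\mathfrak p$. Inner product. $\langle\cdot,\cdot\rangle$ is the $\mathbb R$-bilinear $\mathrm{Ad}_U$-invariant Euclidean inner product on $\mathfrak u^{\mathbb C}$ for which $\mathfrak u\perp i\mathfrak u$, $\langle X,Y\rangle=-\mathrm{Re}\,\mathrm{Tr}(XY)$ for $X,Y\in\mathfrak u$, and $\langle X,Y\rangle=\mathrm{Re}\,\mathrm{Tr}(XY)$ for $X,Y\in i\mathfrak u$. The symbol $\#$ denotes the duality (covectors to vectors) induced by $\langle\cdot,\cdot\rangle$; for a function $h$ on $\mathfrak p$ or $i\mathfrak u$, $(\nabla h)_\xi=\#(dh)_\xi$ is its gradient with respect to $\langle\cdot,\cdot\rangle$ (an element of $\mathfrak p$, resp. $i\mathfrak u$). Gradient map. For $\alpha\in\mathfrak u^*$ let $i\alpha\in(i\mathfrak u)^*$ be $\langle i\alpha|\xi\rangle=\langle\alpha|i\xi\rangle$, $\xi\in i\mathfrak u$. The gradient map is $\mu_{\mathfrak p}(z)=\pi(\#\, i\mu(z))$, with $\pi:\mathfrak u^{\mathbb C}\to\mathfrak p$ the $\langle\cdot,\cdot\rangle$-orthogonal projection. Equivalently, $\langle\mu_{\mathfrak p}(z),\xi\rangle=\langle\mu(z)|i\xi\rangle$ for all $\xi\in\mathfrak p$. Convexity and compatibility. Functions are smooth, and ''strictly convex'' means that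 the Hessian is positive definite at every point. A smooth $F:i\mathfrak u\to\mathbb R$ is $(\mathfrak k,\mathfrak p)$-compatible at $\zeta\in i\mathfrak u$ if the $\langle\cdot,\cdot\rangle$-symmetric endomorphism $\#(\mathrm H F)_\zeta:i\mathfrak u\to i\mathfrak u$, obtained from the Hessian $(\mathrm HF)_\zeta$ of $F$ at $\zeta$ (i.e. $\langle\#(\mathrm HF)_\zeta a,b\rangle=(\mathrm HF)_\zeta(a,b)$), satisfies $\#(\mathrm HF)_\zeta(\mathfrak p)\subseteq\mathfrak p$ and $\#(\mathrm HF)_\zeta(i\mathfrak k)\subseteq i\mathfrak k$. *)

(* Defs.v *)
From HB Require Import structures.
From mathcomp Require Import all_boot all_order all_algebra spectral.
From mathcomp.real_closed Require Export complex.
From mathcomp Require Import all_classical all_reals all_analysis.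
Set Implicit Arguments.
Unset Strict Implicit.
Unset Printing Implicit Defensive.
Import Order.TTheory GRing.Theory Num.Theory.
Import numFieldNormedType.Exports.
Local Open Scope classical_set_scope.
Local Open Scope ring_scope.
Local Open Scope complex_scope.

HB.instance Definition _ (R : realType) := NormedModule.copy R[i] R[i]^o.

Section Smooth.
Variables (R : realType) (V W : normedModType R).

(* C^k on D; only meaningful for D open. *)
Fixpoint Ck_on (k : nat) (D : set V) (f : V -> W) : Prop :=
  if k is k'.+1 then
    (forall x, D x -> differentiable f x) /\
    (forall v : V, Ck_on k' D (fun x => 'D_v f x))
  else forall x, D x -> {for x, continuous f}.

Definition smooth_on (D : set V) (f : V -> W) : Prop := forall k, Ck_on k D f.

(* JV, JW: the complex structures of V and W; the differential is C-linear. *)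
Definition holomorphic_on (JV : V -> V) (JW : W -> W) (D : set V) (f : V -> W)
  : Prop :=
  smooth_on D f /\ forall x v, D x -> 'd f x (JV v) = JW ('d f x v).

End Smooth.

(* C^m as the real vector space R^m x R^m, (a, b) standing for a + i b. *)
Definition cspace (R : realType) (m : nat) : normedModType R := 'rV[R]_(m + m).

Definition cJ (R : realType) (m : nat) (v : cspace R m) : cspace R m :=
  row_mx (- rsubmx v) (lsubmx v).

Definition ccoord (R : realType) (m : nat) (v : cspace R m) (a : 'I_m) : R[i] :=
  (lsubmx v 0 a) +i* (rsubmx v 0 a).

Definition prodJ (R : realType) (d m : nat) (p : (cspace R d * cspace R m)%type)
  : (cspace R d * cspace R m)%type := (cJ p.1, cJ p.2).

(* Second countability is not required: it is automatic when the manifold is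
   compact. The map [psi i] is only meaningful on [phi i @` dom i]. *)
Record complexManifold (R : realType) (m : nat) := ComplexManifold {
  cm_sort :> topologicalType;
  cm_index : Type;
  dom : cm_index -> set cm_sort;
  phi : cm_index -> cm_sort -> cspace R m;
  psi : cm_index -> cspace R m -> cm_sort;
  cm_hausdorff : hausdorff_space cm_sort;
  cm_cover : forall z, exists i, dom i z;
  dom_open : forall i, open (dom i);
  codom_open : forall i, open (phi i @` dom i);
  phiK : forall i z, dom i z -> psi i (phi i z) = z;
  phi_continuous : forall i, {within dom i, continuous (phi i)};
  psi_continuous : forall i, {within phi i @` dom i, continuous (psi i)};
  transition_holomorphic : forall i j,
    holomorphic_on (@cJ R m) (@cJ R m)
      (phi i @` (dom i `&` dom j)) (phi j \o psi i)
}.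

Section Kahler.
Variables (R : realType) (m : nat) (Z : complexManifold R m).

Definition cdom (i : cm_index Z) : set (cspace R m) := phi i @` dom i.

(* [omega i x] is the expression of the form in the chart i, at the point of
   coordinates x; tangent vectors at that point are identified with elements of
   [cspace R m] by the chart, and the complex structure J with [cJ]. The metric
   is Q(v, w) = omega(v, J w). *)
Record kahlerForm := KahlerForm {
  omega :> cm_index Z -> cspace R m -> cspace R m -> cspace R m -> R;
  omega_smooth : forall i v w, smooth_on (cdom i) (fun x => omega i x v w);
  omega_linear : forall i x (a : R) u v w, cdom i x ->
    omega i x (a *: u + v) w = a * omega i x u w + omega i x v w;
  omega_skew : forall i x v w, cdom i x -> omega i x v w = - omega i x w v;
  omega_change : forall i j x v w, (phi i @` (dom i `&` dom j)) x ->
    let tau := phi j \o psi i in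
    omega j (tau x) ('d tau x v) ('d tau x w) = omega i x v w;
  omega_closed : forall i x u v w, cdom i x ->
    'D_u (fun y => omega i y v w) x + 'D_v (fun y => omega i y w u) x
      + 'D_w (fun y => omega i y u v) x = 0;
  omega_J : forall i x v w, cdom i x -> omega i x (cJ v) (cJ w) = omega i x v w;
  omega_pos : forall i x v, cdom i x -> v != 0 -> 0 < omega i x v (cJ v)
}.

(* h preserves J (it is holomorphic) and omega, hence Q. *)
Definition kahler_isometry (om : kahlerForm) (h : Z -> Z) : Prop :=
  continuous h /\
  forall i j, let D := phi i @` (dom i `&` h @^-1` dom j) in
    let H := phi j \o h \o psi i in
    holomorphic_on (@cJ R m) (@cJ R m) D H /\
    forall x v w, D x -> om j (H x) ('d H x v) ('d H x w) = om i x v w.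

Definition critical_point (h : Z -> R) (z : Z) : Prop :=
  forall i, dom i z -> forall v, 'd (h \o psi i) (phi i z) v = 0.

End Kahler.

Section Lie.
Variables (R : realType) (n : nat).
Local Notation M := 'M[R[i]]_n.
Implicit Types (A B xi eta zeta : M) (V W G H U : set M).

Definition expm A : M :=
  lim (series (fun k => (k`!%:R : R[i])^-1 *: A ^+ k : M) @ \oo).

Definition mx_subgroup G : Prop :=
  [/\ G 1%:M, (forall g h, G g -> G h -> G (g *m h)) &
      (forall g, G g -> g \in unitmx /\ G (invmx g))].

(* Every compact subgroup of GL_n(C) is a Lie subgroup. *)
Definition compact_connected_unitary_group U : Prop :=
  [/\ mx_subgroup U, U `<=` [set A | A \is unitarymx], compact U & connected U].

Definition lie H : set M := [set xi | forall t : R, H (expm (t%:C *: xi))].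

Definition adj_action g xi : M := g *m xi *m invmx g.

Definition lie_ad xi eta : M := xi *m eta - eta *m xi.

Definition itimes V : set M := [set 'i *: xi | xi in V].

Definition complexified_group U : set M :=
  [set expm ('i *: eta) *m u | eta in lie U & u in U].

Definition complexified_lie U : set M :=
  [set xi + 'i *: eta | xi in lie U & eta in lie U].

Definition real_subspace V : Prop :=
  V 0 /\ forall (t : R) xi eta, V xi -> V eta -> V (t%:C *: xi + eta).

(* V is the internal direct sum of the real subspaces A i, for i in P. *)
Definition direct_sum (I : eqType) (P : set I) V (A : I -> set M) : Prop :=
  [/\ real_subspace V,
      (forall i, P i -> real_subspace (A i)),
      (forall x, V x <-> exists (s : seq I) (a : I -> M),
         [/\ uniq s, (forall i, i \in s -> P i /\ A i (a i)) &
             x = \sum_(i <- s) a i]) &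
      (forall (s : seq I) (a : I -> M), uniq s ->
         (forall i, i \in s -> P i /\ A i (a i)) ->
         \sum_(i <- s) a i = 0 -> forall i, i \in s -> a i = 0)].

Definition direct_sum2 V (A B : set M) : Prop :=
  direct_sum [set: bool] V (fun b => if b then A else B).

(* Re Tr (A B^* ). On skew-Hermitian matrices this is - Re Tr (A B), on Hermitian
   ones Re Tr (A B), and the two kinds are orthogonal: see ip_u, ip_iu, ip_u_iu. *)
Definition ip A B : R := complex.Re (\tr (A *m map_mx Num.conj B^T)).

(* The metric dual of the linear form l on V. *)
Definition sharp V (l : M -> R) : M :=
  xget 0 [set eta | V eta /\ forall xi, V xi -> ip eta xi = l xi].

Definition orthproj V A : M :=
  xget 0 [set eta | V eta /\ forall xi, V xi -> ip (A - eta) xi = 0].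

(* A function on a real subspace V is given by a total function on matrices, of
   which only the values on V matter. *)

Definition smooth_fun_on V (f : M -> R) : Prop :=
  forall (d : nat) (xi : 'I_d -> M), (forall a, V (xi a)) ->
    smooth_on [set: 'rV[R]_d] (fun s => f (\sum_a (s 0 a)%:C *: xi a)).

Definition dirderiv (f : M -> R) zeta xi : R :=
  derive1 (fun t : R => f (zeta + t%:C *: xi)) 0.

Definition grad V (f : M -> R) zeta : M := sharp V (dirderiv f zeta).

Definition hess (f : M -> R) zeta xi eta : R :=
  dirderiv (fun zeta' => dirderiv f zeta' eta) zeta xi.

Definition hess_endo V (f : M -> R) zeta xi : M := sharp V (hess f zeta xi).

Definition strictly_convex V (f : M -> R) : Prop :=
  forall zeta xi, V zeta -> V xi -> xi != 0 -> 0 < hess f zeta xi xi.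

Definition Ad_invariant H V (f : M -> R) : Prop :=
  forall g xi, H g -> V xi -> f (adj_action g xi) = f xi.

Definition Kgrp U G : set M := G `&` U.
Definition palg U G : set M := lie G `&` itimes (lie U).

Definition real_compatible U G : Prop :=
  [/\ mx_subgroup G,
      (exists2 C : set M, closed C & G = complexified_group U `&` C),
      G = [set k *m expm xi | k in Kgrp U G & xi in palg U G] &
      direct_sum2 (lie G) (lie (Kgrp U G)) (palg U G)].

Definition kp_compatible U G (F : M -> R) zeta : Prop :=
  (forall xi, palg U G xi ->
     palg U G (hess_endo (itimes (lie U)) F zeta xi)) /\
  (forall xi, itimes (lie (Kgrp U G)) xi ->
     itimes (lie (Kgrp U G)) (hess_endo (itimes (lie U)) F zeta xi)).

Lemma ip_u A B : map_mx Num.conj A^T = - A -> map_mx Num.conj B^T = - B ->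
  ip A B = - complex.Re (\tr (A *m B)).
Proof. by move=> _ hB; rewrite /ip hB mulmxN !raddfN. Qed.

Lemma ip_iu A B : map_mx Num.conj A^T = A -> map_mx Num.conj B^T = B ->
  ip A B = complex.Re (\tr (A *m B)).
Proof. by move=> _ hB; rewrite /ip hB. Qed.

Lemma ip_u_iu A B : map_mx Num.conj A^T = - A -> map_mx Num.conj B^T = B ->
  ip A B = 0 /\ ip B A = 0.
Proof.
move=> hA hB.
have h : (\tr (A *m B))^* = - \tr (A *m B).
  have -> : (\tr (A *m B))^* = \tr (map_mx Num.conj (A *m B)^T).
    rewrite /mxtrace rmorph_sum; apply: eq_bigr => i _; by rewrite !mxE.
  by rewrite trmx_mul map_mxM hA hB mulmxN raddfN /= mxtrace_mulC.
have h0 : complex.Re (\tr (A *m B)) = 0.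
  move/(congr1 (@complex.Re R)): h; case: (\tr _) => a b /= ha.
  by apply/eqP; rewrite -[_ == 0](mulrn_eq0 a 2) mulr2n {2}ha subrr.
by rewrite /ip hA hB (mxtrace_mulC B (- A)) mulNmx !raddfN /= h0 oppr0.
Qed.

End Lie.

Section Actions.
Variables (R : realType) (n m : nat) (Z : complexManifold R m).
Local Notation M := 'M[R[i]]_n.
(* Actions of H are total maps of which only the values on H matter. *)
Implicit Types (H U : set M) (act : M -> Z -> Z).

Definition group_action H act : Prop :=
  (forall z, act 1%:M z = z) /\
  (forall g h z, H g -> H h -> act (g *m h) z = act g (act h z)).

Definition continuous_action H act : Prop :=
  {within H `*` [set: Z], continuous (fun p : (M * Z)%type => act p.1 p.2)}.

(* Smoothness of H x Z -> Z is expressed in the coordinates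
   xi |-> exp(xi) g0, xi in Lie(H), of H around g0. *)
Definition smooth_action H act : Prop :=
  [/\ group_action H act, continuous_action H act &
   forall (d : nat) (xi : 'I_d -> M) (g0 : M) (i j : cm_index Z),
     (forall a, lie H (xi a)) -> H g0 ->
     let gs (s : 'rV[R]_d) := expm (\sum_a (s 0 a)%:C *: xi a) *m g0 in
     smooth_on
       [set p : ('rV[R]_d * cspace R m)%type |
         cdom i p.2 /\ dom j (act (gs p.1) (psi i p.2))]
       (fun p => phi j (act (gs p.1) (psi i p.2)))].

(* A holomorphic action of the complexification of U. *)
Definition holomorphic_action U act : Prop :=
  let UC := complexified_group U in
  [/\ group_action UC act, continuous_action UC act &
   forall (d : nat) (xi : 'I_d -> M) (g0 : M) (i j : cm_index Z),
     (forall a, complexified_lie U (xi a)) -> UC g0 ->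
     let gs (s : cspace R d) := expm (\sum_a ccoord s a *: xi a) *m g0 in
     holomorphic_on (@prodJ R d m) (@cJ R m)
       [set p : (cspace R d * cspace R m)%type |
         cdom i p.2 /\ dom j (act (gs p.1) (psi i p.2))]
       (fun p => phi j (act (gs p.1) (psi i p.2)))].

Definition kahler_action (om : kahlerForm Z) U act : Prop :=
  smooth_action U act /\ forall u, U u -> kahler_isometry om (act u).

(* xi_Z(z), in the chart i around z. *)
Definition fund_vec act (i : cm_index Z) (xi : M) (z : Z) : cspace R m :=
  derive1 (fun t : R => phi i (act (expm (t%:C *: xi)) z)) 0.

Definition lie_stab H act (z : Z) : set M :=
  [set xi | lie H xi /\ forall i, dom i z -> fund_vec act i xi z = 0].

(* [mu z xi] is the pairing < mu(z) | xi >, for xi in Lie(U). *)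
Definition momentum_map (om : kahlerForm Z) U act (mu : Z -> M -> R) : Prop :=
  [/\ (forall z (t : R) xi eta, lie U xi -> lie U eta ->
         mu z (t%:C *: xi + eta) = t * mu z xi + mu z eta),
      (forall xi i, lie U xi ->
         smooth_on (cdom i) (fun x => mu (psi i x) xi)),
      (forall xi i z v, lie U xi -> dom i z ->
         'd (fun x => mu (psi i x) xi) (phi i z) v
           = om i (phi i z) v (fund_vec act i xi z)) &
      (forall u z xi, U u -> lie U xi ->
         mu (act u z) xi = mu z (adj_action (invmx u) xi))].

(* The argument of [sharp] is the form i mu(z) on i u. *)
Definition gradient_map U (G : set M) (mu : Z -> M -> R) (z : Z) : M :=
  orthproj (palg U G)
    (sharp (itimes (lie U)) (fun xi => mu z ('i *: xi))).

End Actions.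

(* Main.v *)
Require Import Defs.
From HB Require Import structures.
From mathcomp Require Import all_boot all_order all_algebra spectral.
From mathcomp Require Import all_classical all_reals all_analysis.
Set Implicit Arguments.
Unset Strict Implicit.
Unset Printing Implicit Defensive.
Import Order.TTheory GRing.Theory Num.Theory.
Import numFieldNormedType.Exports.
Local Open Scope classical_set_scope.
Local Open Scope ring_scope.
Local Open Scope complex_scope.

(** Write x for the value of the gradient map at z, beta for the gradient of f
    at x, and <.,.> for [ip]. Three facts carry the proof.

    Since z is critical for f composed with the gradient map, omega pairs every
    tangent vector to zero with the fundamental vector of i beta, so beta lies
    in the stabilizer algebra g_z ([fund_vec_grad]). The flow of beta then fixes
    z ([flow_fixed]), so its adjoint action preserves g_z, and differentiating
    shows that g_z is stable under ad_beta ([stab_ad_grad]). As beta is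
    Hermitian, ad_beta is symmetric with real eigenvalues, and every stable real
    subspace is the sum of its eigenspaces ([ad_prod_eq0], [ad_eigen_decomp]).

    For a in k and b in p, differentiating the equivariance of the momentum map
    along exp(t a) gives omega(a_Z, J b_Z) = <[a, x], b> at z
    ([moment_bracket]), and differentiating the invariance of f gives
    Hess f_x([a, x], b) = <[a, beta], b> ([hess_bracket]).

    Let a + b, with a in k and b in p, be an eigenvector in g_z of eigenvalue l.
    Comparing components, [beta, a] = l b and [beta, b] = l a, while
    a_Z = - b_Z at z. The two identities then combine into
    Hess f_x(y, y) = l omega(b_Z, J b_Z) for y = [a, x] ([eigen_hess]).
    The right-hand factor is a squared norm and the Hessian is positive definite.
    If l < 0 this forces y = 0, hence [a, beta] = 0 and a = b = 0. If l = 0 it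
    also forces y = 0, whence the squared norm of b_Z, which equals - <y, b>,
    vanishes: b, and therefore a, stabilizes z.

    Conversely, elements of k and of p that stabilize z commute with x by
    [moment_bracket]. For a in k, commuting with x implies commuting with beta
    by [hess_bracket]. For b in p, the element [b, beta] of k commutes with x
    because b and beta do, hence commutes with beta, which makes it orthogonal
    to itself: <[b, beta], [b, beta]> = <b, [[b, beta], beta]> = 0. *)

(** * Limits of complex numbers and of matrices *)

Section ComplexTopology.
Variable R : realType.

Lemma normc_lt (w : R[i]) (e : R) :
  `|complex.Re w| < e / 2 -> `|complex.Im w| < e / 2 -> `|w| < e%:C.
Proof.
case: w => a b /= ha hb.
have -> : a +i* b = a%:C + 'i * b%:C by rewrite [LHS]complexE.
have nR (r : R) : `|r%:C| = `|r|%:C.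
  by rewrite normc_def /= expr0n addr0 sqrtr_sqr.
have ni : `|'i : R[i]| = 1 by rewrite normc_def /= expr0n add0r expr1n sqrtr1.
apply: (le_lt_trans (ler_normD _ _)).
by rewrite normrM ni mul1r !nR -rmorphD ltcR (splitr e) ltrD.
Qed.

Lemma ReB (x y : R[i]) : complex.Re (x - y) = complex.Re x - complex.Re y.
Proof. by case: x => ? ?; case: y. Qed.

Lemma ImB (x y : R[i]) : complex.Im (x - y) = complex.Im x - complex.Im y.
Proof. by case: x => ? ?; case: y. Qed.

Lemma cvg_complex (T : Type) (F : set_system T) (FF : Filter F)
    (f : T -> R[i]) (l : R[i]) :
  complex.Re (f x) @[x --> F] --> complex.Re l ->
  complex.Im (f x) @[x --> F] --> complex.Im l ->
  f x @[x --> F] --> l.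
Proof.
move=> /cvgrPdist_lt hr /cvgrPdist_lt hi; apply/cvgrPdist_lt => e e0.
have {e e0} [r -> r0] : exists2 r : R, e = r%:C & 0 < r.
  case: e e0 => a b; rewrite ltcE /= => /andP[/eqP -> a0].
  by exists a.
have r20 : 0 < r / 2 by rewrite divr_gt0.
apply: filterS2 (hr _ r20) (hi _ r20) => x hx hy.
apply: normc_lt.
  by rewrite ReB.
by rewrite ImB.
Qed.

Lemma Re_continuous : continuous (@complex.Re R : R[i] -> R).
Proof.
move=> x; apply: (proj2 (@cvgrPdist_lt _ _ _ (nbhs x) (nbhs_filter x) _ _)) => e e0.
have ec : 0 < e%:C :> R[i] by rewrite ltcR.
near=> y.
have : `|x - y| < e%:C by near: y; apply: cvgr_dist_lt.
rewrite -ReB normc_def ltcR; apply: le_lt_trans.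
by rewrite -[leLHS]sqrtr_sqr ler_wsqrtr // lerDl sqr_ge0.
Unshelve. all: by end_near. Qed.

Lemma Im_continuous : continuous (@complex.Im R : R[i] -> R).
Proof.
move=> x; apply: (proj2 (@cvgrPdist_lt _ _ _ (nbhs x) (nbhs_filter x) _ _)) => e e0.
have ec : 0 < e%:C :> R[i] by rewrite ltcR.
near=> y.
have : `|x - y| < e%:C by near: y; apply: cvgr_dist_lt.
rewrite -ImB normc_def ltcR; apply: le_lt_trans.
by rewrite -[leLHS]sqrtr_sqr ler_wsqrtr // lerDr sqr_ge0.
Unshelve. all: by end_near. Qed.

End ComplexTopology.

Lemma cvg_mx_entries (S : topologicalType) (p q : nat) (T : Type) (F : set_system T)
    (FF : Filter F) (f : T -> 'M[S]_(p, q)) (l : 'M[S]_(p, q)) :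
  (forall i j, f x i j @[x --> F] --> l i j) -> f x @[x --> F] --> l.
Proof.
move=> h A [P hP PA] /=.
have : \forall x \near F, forall i j, P i j (f x i j).
  by apply: filter_forall => i; apply: filter_forall => j; apply: h.
by apply: filterS => x hx; apply: PA.
Qed.

Lemma mx_entry_continuous (S : topologicalType) (p q : nat) i j :
  continuous (fun A : 'M[S]_(p, q) => A i j).
Proof.
move=> A B nB; exists (fun i' j' => if (i' == i) && (j' == j) then B else setT).
  move=> i' j'; case: ifP => [/andP[/eqP -> /eqP ->] //|_]; exact: filterT.
by move=> C /= /(_ i j); rewrite !eqxx.
Qed.

(** * The real inner product on complex matrices *)

Section InnerProduct.
Variables (R : realType) (n : nat).
Local Notation M := 'M[R[i]]_n.
Implicit Types (A B C D E : M) (a : R).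

Definition ctr A : M := map_mx Num.conj A^T.

Lemma ctrE A i j : ctr A i j = (A j i)^*.
Proof. by rewrite !mxE. Qed.

Lemma ctrK A : ctr (ctr A) = A.
Proof. by apply/matrixP => i j; rewrite !ctrE conjcK. Qed.

Lemma ctrD A B : ctr (A + B) = ctr A + ctr B.
Proof. by rewrite /ctr linearD map_mxD. Qed.

Lemma ctrN A : ctr (- A) = - ctr A.
Proof. by rewrite /ctr linearN map_mxN. Qed.

Lemma ctrB A B : ctr (A - B) = ctr A - ctr B.
Proof. by rewrite ctrD ctrN. Qed.

Lemma ctrM A B : ctr (A *m B) = ctr B *m ctr A.
Proof. by rewrite /ctr trmx_mul map_mxM. Qed.

Lemma ctrZ (c : R[i]) A : ctr (c *: A) = c^* *: ctr A.
Proof. by apply/matrixP => i j; rewrite !mxE rmorphM. Qed.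

Lemma ctrZi A : ctr ('i *: A) = - ('i *: ctr A).
Proof.
rewrite ctrZ -scaleNr; congr (_ *: _).
rewrite -[Num.imaginary]/(0 +i* 1) -[LHS]/(0 -i* 1) -[RHS]/(- 0 -i* 1).
by rewrite oppr0.
Qed.

Lemma ctr1 : ctr 1%:M = 1%:M.
Proof. by apply/matrixP => i j; rewrite ctrE !mxE eq_sym; exact: conjc_nat. Qed.

Lemma ReM (x y : R[i]) : complex.Re (x * y) =
  complex.Re x * complex.Re y - complex.Im x * complex.Im y.
Proof. by case: x => ? ?; case: y. Qed.

Lemma ipE A B : ip A B = \sum_i \sum_j
  (complex.Re (A i j) * complex.Re (B i j)
   + complex.Im (A i j) * complex.Im (B i j)).
Proof.
rewrite /ip /mxtrace raddf_sum /=; apply: eq_bigr => i _.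
rewrite mxE raddf_sum /=; apply: eq_bigr => j _.
rewrite !mxE ReM; case: (A i j) => ? ?; case: (B i j) => ? ? /=.
by rewrite mulrN opprK.
Qed.

Lemma ipC A B : ip A B = ip B A.
Proof.
by rewrite !ipE; do 2![apply: eq_bigr => ? _]; congr (_ + _); rewrite mulrC.
Qed.

Lemma ipDl A B C : ip (A + B) C = ip A C + ip B C.
Proof. by rewrite /ip mulmxDl !raddfD. Qed.

Lemma ipZl a A B : ip (a%:C *: A) B = a * ip A B.
Proof.
by rewrite /ip -scalemxAl linearZ /= ReM /= mul0r subr0.
Qed.

Lemma ipNl A B : ip (- A) B = - ip A B.
Proof. by rewrite /ip mulNmx !raddfN. Qed.

Lemma ipDr A B C : ip A (B + C) = ip A B + ip A C.
Proof. by rewrite ![ip A _]ipC ipDl. Qed.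
Lemma ipZr a A B : ip A (a%:C *: B) = a * ip A B.
Proof. by rewrite ![ip A _]ipC ipZl. Qed.
Lemma ipNr A B : ip A (- B) = - ip A B.
Proof. by rewrite ![ip A _]ipC ipNl. Qed.
Lemma ipBl A B C : ip (A - B) C = ip A C - ip B C.
Proof. by rewrite ipDl ipNl. Qed.
Lemma ipBr A B C : ip A (B - C) = ip A B - ip A C.
Proof. by rewrite ipDr ipNr. Qed.
Lemma ip0l A : ip 0 A = 0.
Proof. by rewrite -(subrr (0 : M)) ipBl subrr. Qed.
Lemma ip0r A : ip A 0 = 0.
Proof. by rewrite ipC ip0l. Qed.

Lemma ip_sumr (I : Type) (s : seq I) (P : pred I) A (F : I -> M) :
  ip A (\sum_(i <- s | P i) F i) = \sum_(i <- s | P i) ip A (F i).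
Proof. by apply: (big_morph (ip A)) => [B C|]; rewrite ?ipDr ?ip0r. Qed.

Lemma ip_suml (I : Type) (s : seq I) (P : pred I) A (F : I -> M) :
  ip (\sum_(i <- s | P i) F i) A = \sum_(i <- s | P i) ip (F i) A.
Proof. by rewrite ipC ip_sumr; apply: eq_bigr => i _; rewrite ipC. Qed.

Lemma ip_ge0 A : 0 <= ip A A.
Proof.
by rewrite ipE; do 2![apply: sumr_ge0 => ? _]; rewrite addr_ge0 // -expr2 sqr_ge0.
Qed.

Lemma ip_eq0 A : ip A A = 0 -> A = 0.
Proof.
rewrite ipE => /eqP; rewrite psumr_eq0; last first.
  by move=> i _; apply: sumr_ge0 => j _; rewrite addr_ge0 // -expr2 sqr_ge0.
move=> /allP h; apply/matrixP => i j; rewrite mxE.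
have := h i (mem_index_enum i); rewrite psumr_eq0; last first.
  by move=> k _; rewrite addr_ge0 // -expr2 sqr_ge0.
move=> /allP /(_ j (mem_index_enum j)) /=.
rewrite paddr_eq0 -?expr2 ?sqr_ge0 // !sqrf_eq0 => /andP[/eqP hr /eqP hi].
by move: hr hi; case: (A i j) => a b /= -> ->.
Qed.

Lemma ip_mull C A B : ip (C *m A) B = ip A (ctr C *m B).
Proof.
by rewrite /ip -/(ctr B) -/(ctr (_ *m _)) ctrM ctrK mulmxA -mulmxA mxtrace_mulC.
Qed.

Lemma ip_mulr C A B : ip (A *m C) B = ip A (B *m ctr C).
Proof. by rewrite /ip -/(ctr B) -/(ctr (_ *m _)) ctrM ctrK mulmxA. Qed.

Lemma ip_Re i j A : ip (delta_mx i j) A = complex.Re (A i j).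
Proof.
rewrite ipE (bigD1 i) //= (bigD1 j) //= !mxE !eqxx mul1r mul0r addr0.
rewrite big1 ?addr0 => [|k /negPf hk]; last by rewrite !mxE hk andbF !mul0r addr0.
rewrite big1 ?addr0 // => k /negPf hk.
by apply: big1 => l _; rewrite !mxE hk !mul0r addr0.
Qed.

Lemma ip_Im i j A : ip ('i *: delta_mx i j) A = complex.Im (A i j).
Proof.
rewrite ipE (bigD1 i) //= (bigD1 j) //= !mxE !eqxx mulr1 mul1r mul0r add0r.
rewrite big1 ?addr0 => [|k /negPf hk].
  rewrite big1 ?addr0 // => k /negPf hk.
  by apply: big1 => l _; rewrite !mxE hk mulr0 !mul0r addr0.
by rewrite !mxE hk andbF mulr0 !mul0r addr0.
Qed.

Lemma mx_ReIm C : C = \sum_i \sum_j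
  ((ip (delta_mx i j) C)%:C *: delta_mx i j
   + (ip ('i *: delta_mx i j) C)%:C *: ('i *: delta_mx i j)).
Proof.
rewrite {1}[C]matrix_sum_delta; do 2![apply: eq_bigr => ? _].
rewrite ip_Re ip_Im scalerA -scalerDl; congr (_ *: _).
by rewrite mulrC -complexE.
Qed.

Lemma ip_inj A B : (forall E, ip E A = ip E B) -> A = B.
Proof.
by move=> h; apply/eqP; rewrite -subr_eq0; apply/eqP/ip_eq0; rewrite ipBr h subrr.
Qed.

End InnerProduct.

(** * The exponential series *)

Section ExpSeries.
Variables (R : realType) (n : nat).
Local Notation M := 'M[R[i]]_n.
Implicit Types (A B C D E : M) (a : R).

(** Geometric growth of c makes the series of c k / k! x^k dominated by an
    exponential series, for every x. *)
Lemma cvg_pseries_fact (c : nat -> R) (K r x : R) : 0 <= r ->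
  (forall k, `|c k| <= K * r ^+ k) ->
  cvgn (pseries (fun k => c k / k`!%:R) x).
Proof.
move=> r0 hc; apply: normed_cvg.
have hK : 0 <= K by have := hc 0%N; rewrite expr0 mulr1; exact: le_trans.
have h : cvgn (series (fun k => K * exp_coeff (r * `|x|) k)).
  apply: is_cvg_seriesZ; exact: is_cvg_series_exp_coeff.
apply: series_le_cvg h => [k|k|k] //=.
  by rewrite /exp_coeff /= mulr_ge0 // divr_ge0 // exprn_ge0 // mulr_ge0.
rewrite /exp_coeff /= !normrM normfV normr_nat normrX exprMn mulrAC.
rewrite !mulrA ler_pM2r ?invr_gt0 ?ltr0n ?fact_gt0 //.
by rewrite ler_wpM2r // exprn_ge0.
Qed.

(** The sum r of the moduli of all entries of A bounds the entries of each
    power: in the entry (i, j) of A A^k, the i-th row of A contributes at most r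
    and the entries of A^k at most r^k. *)
Lemma mx_exp_bound A : exists2 r : R, 0 <= r &
  forall k i j, `|(A ^+ k) i j| <= (r ^+ k)%:C.
Proof.
pose s : R[i] := \sum_i \sum_j `|A i j|.
have s0 : 0 <= s by do 2![apply: sumr_ge0 => ? _].
have sE : s = (complex.Re s)%:C.
  by move: (ger0_Im s0); case: s {s0} => u v /= ->.
exists (complex.Re s); first by rewrite -ler0c -sE.
move=> k i j; rewrite rmorphXn /= -sE.
elim: k i j => [|k IHk] i j.
  by rewrite !expr0 mxE; case: eqP => _; rewrite ?normr1 ?normr0.
rewrite !exprS mxE; apply: le_trans (ler_norm_sum _ _ _) _.
have h l : `|A i l * (A ^+ k) l j| <= `|A i l| * s ^+ k.
  by rewrite normrM ler_wpM2l.
apply: le_trans (ler_sum _ (fun l _ => h l)) _.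
rewrite -mulr_suml ler_wpM2r ?exprn_ge0 //.
rewrite /s [leRHS](bigD1 i) //= lerDl.
by apply: sumr_ge0 => ? _; apply: sumr_ge0.
Qed.

Lemma ReIm_le (w : R[i]) (r : R) : `|w| <= r%:C ->
  `|complex.Re w| <= r /\ `|complex.Im w| <= r.
Proof.
rewrite normc_def lecR => h; split; apply: le_trans h.
  by rewrite -[leLHS]sqrtr_sqr ler_wsqrtr // lerDl sqr_ge0.
by rewrite -[leLHS]sqrtr_sqr ler_wsqrtr // lerDr sqr_ge0.
Qed.

Lemma ip_exp_bound A : exists2 r : R, 0 <= r &
  forall E, exists K, forall k, `|ip E (A ^+ k)| <= K * r ^+ k.
Proof.
have [r r0 h] := mx_exp_bound A; exists r => // E.
exists (\sum_i \sum_j (`|complex.Re (E i j)| + `|complex.Im (E i j)|)) => k.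
rewrite ipE mulr_suml; apply: le_trans (ler_norm_sum _ _ _) _.
apply: ler_sum => i _; rewrite mulr_suml.
apply: le_trans (ler_norm_sum _ _ _) _; apply: ler_sum => j _.
have [h1 h2] := ReIm_le (h k i j).
apply: le_trans (ler_normD _ _) _; rewrite mulrDl !normrM.
by apply: lerD; apply: ler_wpM2l.
Qed.

Definition exp_series A : nat -> M :=
  series (fun k => (k`!%:R : R[i])^-1 *: A ^+ k : M).

Lemma complex_natV (k : nat) : (k%:R : R[i])^-1 = (k%:R^-1 : R)%:C.
Proof. by rewrite fmorphV rmorph_nat. Qed.

Lemma mxpow_scale (c : R[i]) A k : (c *: A) ^+ k = c ^+ k *: A ^+ k.
Proof.
elim: k => [|k IHk]; first by rewrite !expr0 scale1r.
by rewrite !exprS IHk /= -[LHS]scalemxAl -scalemxAr scalerA.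
Qed.

Lemma ip_exp_series A E t k : ip E (exp_series (t%:C *: A) k) =
  pseries (fun k => ip E (A ^+ k) / k`!%:R) t k.
Proof.
rewrite /exp_series /pseries /series /= ip_sumr; apply: eq_bigr => l _.
rewrite mxpow_scale complex_natV scalerA -rmorphXn -rmorphM ipZr.
by rewrite mulrC mulrA.
Qed.

Lemma cvg_exp_series A : exp_series A @ \oo --> expm A.
Proof.
suff [L hL] : exists L : M, exp_series A @ \oo --> L by exact: (cvgP L hL).
have [r r0 hr] := ip_exp_bound A.
have hE E : cvgn (fun k => ip E (exp_series A k)).
  have [K hK] := hr E; have h1 := cvg_pseries_fact (x := 1) r0 hK.
  suff -> : (fun k => ip E (exp_series A k)) =
    pseries (fun k => ip E (A ^+ k) / k`!%:R) 1 by [].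
  by apply/funext => k; rewrite -ip_exp_series scale1r.
exists (\matrix_(i, j)
  (limn (fun k => ip (delta_mx i j) (exp_series A k)) +i*
   limn (fun k => ip ('i *: delta_mx i j) (exp_series A k)))).
apply: cvg_mx_entries => i j; apply: cvg_complex.
  under eq_fun do rewrite -ip_Re.
  by rewrite mxE /=; exact: hE.
under eq_fun do rewrite -ip_Im.
by rewrite mxE /=; exact: hE.
Qed.

Lemma cvg_ip (T : Type) (F : set_system T) (FF : Filter F) (f : T -> M) A E :
  f x @[x --> F] --> A -> ip E (f x) @[x --> F] --> ip E A.
Proof.
move=> fA; under eq_fun do rewrite ipE.
have hc i j : f x i j @[x --> F] --> A i j.
  by apply: (cvg_comp f (fun B : M => B i j) fA); exact: mx_entry_continuous.
rewrite ipE; apply: cvg_big => [|i _]; first by move=> x; apply: add_continuous.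
apply: cvg_big => [|j _]; first by move=> x; apply: add_continuous.
apply: cvgD; apply: cvgM; try exact: cvg_cst.
  by apply: continuous_cvg (hc i j); apply: Re_continuous.
by apply: continuous_cvg (hc i j); apply: Im_continuous.
Qed.

Lemma ip_expm A E t : ip E (expm (t%:C *: A)) =
  limn (pseries (fun k => ip E (A ^+ k) / k`!%:R) t).
Proof.
apply/esym/cvg_lim => //.
have <- : (fun k => ip E (exp_series (t%:C *: A) k)) =
  pseries (fun k => ip E (A ^+ k) / k`!%:R) t.
  by apply/funext => k; rewrite ip_exp_series.
refine (cvg_ip eventually_filter (E := E) (cvg_exp_series (A := t%:C *: A))).
Qed.

(** Paired with E, the curve t |-> exp(t A) is the power series of coefficients
    <E, A^k> / k!; differentiating it termwise replaces A^k by A^(k+1). *)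
Lemma is_derive_ip_expm A E t :
  is_derive t (1 : R) (fun s => ip E (expm (s%:C *: A)))
    (ip E (A *m expm (t%:C *: A))).
Proof.
under eq_fun do rewrite ip_expm.
have [r r0 hr] := ip_exp_bound A.
have hd (F : M) : pseries_diffs (fun k => ip F (A ^+ k) / k`!%:R) =
    (fun k => ip (ctr A *m F) (A ^+ k) / k`!%:R).
  apply/funext => k; rewrite /pseries_diffs factS natrM invfM exprS.
  by rewrite [in RHS]ip_mull ctrK mulrCA mulVKf.
rewrite -[A in ip E (A *m _)]ctrK -ip_mull ip_expm -hd.
have c F x : cvgn (pseries (fun k => ip F (A ^+ k) / k`!%:R) x).
  by have [K hK] := hr F; exact: cvg_pseries_fact hK.
apply: (@pseries_snd_diffs _ _ (`|t| + 1)); rewrite ?hd //; try exact: c.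
by rewrite [ltRHS]ger0_norm ?ltrDl // addr_ge0.
Qed.

End ExpSeries.

(** * Matrix curves and the exponential *)

#[local] Opaque expm.

Section MatrixCurves.
Variables (R : realType) (n : nat).
Local Notation M := 'M[R[i]]_n.
Implicit Types (A B C D E P Q : M) (c d : R -> M) (t s : R).

Lemma ip_adjl A B C : ip A (C *m B) = ip (ctr C *m A) B.
Proof. by rewrite ipC ip_mull ipC. Qed.

Lemma ip_adjr A B C : ip A (B *m C) = ip (A *m ctr C) B.
Proof. by rewrite ipC ip_mulr ipC. Qed.

(** Matrices are normed over the complex numbers while the parameter of a curve
    is real, so derivatives of curves are taken through the real functionals
    [ip E], which separate matrices. *)
Definition is_mxderive c t B : Prop :=
  forall E, is_derive t (1 : R) (fun s => ip E (c s)) (ip E B).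

Lemma is_mxderive_eq c t B C : is_mxderive c t B -> B = C -> is_mxderive c t C.
Proof. by move=> h <-. Qed.

Lemma is_mxderive_cst B t : is_mxderive (fun=> B) t 0.
Proof. by move=> E; rewrite ip0r; exact: is_derive_cst. Qed.

Lemma is_mxderiveD c d t B C : is_mxderive c t B -> is_mxderive d t C ->
  is_mxderive (fun s => c s + d s) t (B + C).
Proof.
move=> hc hd E; rewrite ipDr; under eq_fun do rewrite ipDr.
exact: is_deriveD (hc E) (hd E).
Qed.

Lemma is_mxderiveN c t B : is_mxderive c t B ->
  is_mxderive (fun s => - c s) t (- B).
Proof.
move=> hc E; rewrite ipNr; under eq_fun do rewrite ipNr.
exact: is_deriveN (hc E).
Qed.

Lemma is_mxderive_mull P c t B : is_mxderive c t B ->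
  is_mxderive (fun s => P *m c s) t (P *m B).
Proof.
move=> hc E; rewrite ip_adjl; under eq_fun do rewrite ip_adjl.
exact: hc.
Qed.

Lemma is_mxderive_mulr Q c t B : is_mxderive c t B ->
  is_mxderive (fun s => c s *m Q) t (B *m Q).
Proof.
move=> hc E; rewrite ip_adjr; under eq_fun do rewrite ip_adjr.
exact: hc.
Qed.

Lemma ip_ctr A B : ip A (ctr B) = ip (ctr A) B.
Proof.
rewrite !ipE exchange_big; do 2![apply: eq_bigr => ? _]; rewrite !ctrE.
by case: (A _ _) => ? ?; case: (B _ _) => ? ? /=; rewrite mulrN mulNr.
Qed.

Lemma is_mxderive_ctr c t B : is_mxderive c t B ->
  is_mxderive (fun s => ctr (c s)) t (ctr B).
Proof.
move=> hc E; rewrite ip_ctr; under eq_fun do rewrite ip_ctr.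
exact: hc.
Qed.

Lemma ip_mulE E C D : ip E (C *m D) = \sum_i \sum_j
  (ip (delta_mx i j) C * ip E (delta_mx i j *m D)
   + ip ('i *: delta_mx i j) C * ip E ('i *: delta_mx i j *m D)).
Proof.
rewrite {1}[C]mx_ReIm mulmx_suml ip_sumr; apply: eq_bigr => i _.
rewrite mulmx_suml ip_sumr; apply: eq_bigr => j _.
by rewrite mulmxDl ipDr -!scalemxAl !ipZr.
Qed.

(** Expanding the left factor in its real coordinates turns each functional of
    the product into a finite sum of products of real functions. *)
Lemma is_mxderiveM c d t B C : is_mxderive c t B -> is_mxderive d t C ->
  is_mxderive (fun s => c s *m d s) t (B *m d t + c t *m C).
Proof.
move=> hc hd E; under eq_fun do rewrite ip_mulE.
have h (F G : M) : is_derive t (1 : R) (fun s => ip F (c s) * ip E (G *m d s))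
    (ip F B * ip E (G *m d t) + ip F (c t) * ip E (G *m C)).
  have hm := is_deriveM (hc F) (is_mxderive_mull G hd E).
  apply: is_derive_eq hm _.
  by rewrite addrC [X in X + _ = _]mulrC.
have hs (k : nat) (f : 'I_k -> R -> R) (df : 'I_k -> R) :
    (forall i, is_derive t (1 : R) (f i) (df i)) ->
    is_derive t (1 : R) (fun s => \sum_(i < k) f i s) (\sum_(i < k) df i).
  by move=> hf; rewrite -fct_sumE; exact: is_derive_sum.
have H := hs n _ _ (fun i => hs n _ _ (fun j => is_deriveD
  (h (delta_mx i j) (delta_mx i j)) (h ('i *: delta_mx i j) ('i *: delta_mx i j)))).
apply: is_derive_eq H _.
rewrite ipDr !ip_mulE -big_split; apply: eq_bigr => i _ /=.
by rewrite -big_split; apply: eq_bigr => j _ /=; rewrite addrACA.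
Qed.

Lemma is_mxderive_shift c t s B : is_mxderive c (t + s) B ->
  is_mxderive (fun r => c (r + s)) t B.
Proof.
move=> hc E; rewrite -[ip E B]mulr1.
exact: (@is_derive1_comp _ (fun r => ip E (c r)) (shift s) t _ _ (hc E)
  (is_derive_shift t 1 s)).
Qed.

Lemma is_mxderive_unique c t B C : is_mxderive c t B -> is_mxderive c t C ->
  B = C.
Proof.
move=> hB hC; apply: ip_inj => E.
by have [_ <-] := hB E; have [_ <-] := hC E.
Qed.

Lemma is_mxderive0_cst c : (forall t, is_mxderive c t 0) ->
  forall t s, c t = c s.
Proof.
move=> h t s; apply: ip_inj => E.
apply: (@is_derive_0_is_cst _ (fun t => ip E (c t))) => x.
by have := h x E; rewrite ip0r.
Qed.

Lemma is_mxderive_continuous c t B : is_mxderive c t B -> {for t, continuous c}.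
Proof.
move=> hc.
have h E : {for t, continuous (fun s => ip E (c s))}.
  by apply: differentiable_continuous; apply/derivable1_diffP; have [] := hc E.
apply: cvg_mx_entries => i j; apply: cvg_complex.
  by rewrite -ip_Re; under eq_fun do rewrite -ip_Re; exact: h.
by rewrite -ip_Im; under eq_fun do rewrite -ip_Im; exact: h.
Qed.

Lemma is_mxderive_expm A t :
  is_mxderive (fun s => expm (s%:C *: A)) t (A *m expm (t%:C *: A)).
Proof. by move=> E; exact: is_derive_ip_expm. Qed.

Lemma is_mxderive_expmN A t :
  is_mxderive (fun s => expm ((- s)%:C *: A)) t (- A *m expm ((- t)%:C *: A)).
Proof.
have hN (r : R) : (- r)%:C *: A = r%:C *: - A.
  by rewrite scalerN -scaleNr rmorphN.
by move=> E; rewrite hN; under eq_fun do rewrite hN; exact: is_mxderive_expm.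
Qed.

(** The functionals of exp(t A) only depend on those of the powers of A, so that
    algebraic identities between powers pass to the exponential. *)
Lemma ip_expm_eq A B E F t :
  (forall k, ip E (A ^+ k) = ip F (B ^+ k)) ->
  ip E (expm (t%:C *: A)) = ip F (expm (t%:C *: B)).
Proof.
move=> h; rewrite !ip_expm.
have e (g1 g2 : nat -> R) : g1 = g2 -> limn (pseries g1 t) = limn (pseries g2 t).
  by move=> ->.
by apply: e; apply/funext => k; rewrite h.
Qed.

Lemma expm0 : expm (0 : M) = 1%:M.
Proof.
apply: ip_inj => E; rewrite -[X in expm X](scale0r (0 : M)) -[X in X *: _]/(0%:C).
rewrite ip_expm; apply/cvg_lim => //.
apply: (@cvg_trans _ (cst (ip E 1%:M) x @[x --> \oo])); last exact: cvg_cst.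
apply: near_eq_cvg; exists 1%N => // -[//|k] _.
rewrite /pseries /series /= big_nat_recl //= big1 ?addr0 => [|i _].
  by rewrite !expr0 mulr1 fact0 divr1.
by rewrite [X in _ * X]exprS mul0r mulr0.
Qed.

Lemma expm_comm A t : A *m expm (t%:C *: A) = expm (t%:C *: A) *m A.
Proof.
apply: ip_inj => E; rewrite ip_adjl [RHS]ip_adjr.
apply: ip_expm_eq => k; rewrite -ip_adjl -ip_adjr; congr ip.
by rewrite -[LHS]exprS exprSr.
Qed.

(** Taking r = s and r' = 0 in the hypothesis, with x = t, gives
    e (s + t) e (- s) = e t; and e (- s) is inverse to e s by x = 0. *)
Lemma one_parameter_group (e : R -> M) : e 0 = 1%:M ->
  (forall x r r', e (r + x) *m e (- r) = e (r' + x) *m e (- r')) ->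
  forall s t, e (s + t) = e s *m e t.
Proof.
move=> e0 h.
have inv r : e (- r) *m e r = 1%:M.
  by have := h 0 (- r) 0; rewrite !addr0 opprK oppr0 e0 mulmx1.
have h1 s t : e (s + t) = e t *m e s.
  have := h t s 0; rewrite add0r oppr0 e0 mulmx1 => <-.
  by rewrite -mulmxA inv mulmx1.
by move=> s t; rewrite addrC h1.
Qed.

(** The curve r |-> exp((r + x) A) exp(- r A) is constant, because A commutes
    with its exponentials and the derivative therefore vanishes. *)
Lemma expmD A s t : expm ((s + t)%:C *: A) = expm (s%:C *: A) *m expm (t%:C *: A).
Proof.
have h0 (X Y : M) : A *m X = X *m A -> A *m X *m Y + X *m (- A *m Y) = 0.
  by move=> ->; rewrite mulNmx mulmxN mulmxA subrr.
have h1 x r r' : expm ((r + x)%:C *: A) *m expm ((- r)%:C *: A) =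
   expm ((r' + x)%:C *: A) *m expm ((- r')%:C *: A).
  apply: (@is_mxderive0_cst
    (fun r => expm ((r + x)%:C *: A) *m expm ((- r)%:C *: A))) => y.
  have d1 := is_mxderive_shift (c := fun r => expm (r%:C *: A))
    (is_mxderive_expm A (y + x)).
  have d2 := is_mxderive_expmN A y.
  apply: is_mxderive_eq (is_mxderiveM d1 d2) _.
  by apply: h0; exact: expm_comm.
apply: (one_parameter_group (e := fun r => expm (r%:C *: A))) => //.
by rewrite /= scale0r expm0.
Qed.

Lemma expmN A t : expm (t%:C *: A) *m expm ((- t)%:C *: A) = 1%:M.
Proof. by rewrite -expmD subrr scale0r expm0. Qed.

Lemma expm_unit A t : expm (t%:C *: A) \in unitmx.
Proof. exact (proj1 (mulmx1_unit (expmN A t))). Qed.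

Lemma expm_inv A t : invmx (expm (t%:C *: A)) = expm ((- t)%:C *: A).
Proof.
by rewrite -[RHS](mulKmx (expm_unit A t)) expmN mulmx1.
Qed.

Lemma expm_conj P A t : P \in unitmx ->
  P *m expm (t%:C *: A) *m invmx P = expm (t%:C *: (P *m A *m invmx P)).
Proof.
move=> uP; apply: ip_inj => E.
rewrite ip_adjr ip_adjl; apply: ip_expm_eq => k.
rewrite -ip_adjl -ip_adjr; congr ip.
elim: k => [|k IHk]; first by rewrite !expr0 mulmx1 mulmxV.
rewrite !exprS -IHk -[RHS]/(_ *m _) -[X in P *m X]/(_ *m _).
by rewrite !mulmxA mulmxKV.
Qed.

Lemma expm_ctr A t : ctr (expm (t%:C *: A)) = expm (t%:C *: ctr A).
Proof.
apply: ip_inj => E; rewrite ip_ctr; apply: ip_expm_eq => k.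
rewrite -ip_ctr; congr ip; elim: k => [|k IHk]; first by rewrite !expr0 ctr1.
by rewrite exprS [RHS]exprSr -IHk; exact: ctrM.
Qed.

Lemma expm_continuous A : continuous (fun t : R => expm (t%:C *: A) : M).
Proof. by move=> t; exact: is_mxderive_continuous (is_mxderive_expm A t). Qed.

Lemma is_mxderive_Ad A B :
  is_mxderive (fun t => adj_action (expm (t%:C *: A)) B) 0 (lie_ad A B).
Proof.
rewrite /adj_action; under eq_fun do rewrite expm_inv.
have d := is_mxderiveM (is_mxderive_mulr B (is_mxderive_expm A 0))
  (is_mxderive_expmN A 0).
apply: is_mxderive_eq d _.
by rewrite oppr0 !scale0r expm0 !mulmx1 mul1mx mulmxN.
Qed.

End MatrixCurves.

(** * Real subspaces and their orthonormal bases *)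

Section RealSubspaces.
Variables (R : realType) (n : nat).
Local Notation M := 'M[R[i]]_n.
Implicit Types (A B C D E : M) (V W : set M) (t : R).

Lemma subspace0 V : real_subspace V -> V 0.
Proof. by case. Qed.

Lemma subspaceZ V t A : real_subspace V -> V A -> V (t%:C *: A).
Proof. by move=> [V0 VP] VA; rewrite -[_ *: _]addr0; exact: VP. Qed.

Lemma subspaceD V A B : real_subspace V -> V A -> V B -> V (A + B).
Proof. by move=> [V0 VP] VA VB; rewrite -[A]scale1r; exact: (VP 1). Qed.

Lemma subspaceN V A : real_subspace V -> V A -> V (- A).
Proof.
move=> hV VA; rewrite -scaleN1r.
have -> : (-1 : R[i]) = (-1)%:C by rewrite rmorphN1.
exact: subspaceZ.
Qed.

Lemma subspaceB V A B : real_subspace V -> V A -> V B -> V (A - B).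
Proof. by move=> hV VA VB; apply: subspaceD => //; exact: subspaceN. Qed.

Lemma subspace_sum V (I : Type) (s : seq I) (P : pred I) (F : I -> M) :
  real_subspace V -> (forall i, P i -> V (F i)) -> V (\sum_(i <- s | P i) F i).
Proof.
move=> hV hF; elim/big_rec: _ => [|i B Pi VB]; first exact: subspace0.
by apply: subspaceD => //; exact: hF.
Qed.

Lemma subspaceI V W : real_subspace V -> real_subspace W ->
  real_subspace (V `&` W).
Proof.
move=> [V0 VP] [W0 WP]; split; first by [].
by move=> t A B [VA WA] [VB WB]; split; [exact: VP | exact: WP].
Qed.

Definition orthonormal k (e : nat -> M) : Prop :=
  forall a b, (a < k)%N -> (b < k)%N -> ip (e a) (e b) = (a == b)%:R.

Definition proj k (e : nat -> M) A : M := \sum_(a < k) (ip (e a) A)%:C *: e a.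

Lemma ip_proj k e A b : orthonormal k e -> (b < k)%N ->
  ip (e b) (proj k e A) = ip (e b) A.
Proof.
move=> he hb; rewrite ip_sumr (bigD1 (Ordinal hb)) //= ipZr he // eqxx mulr1.
rewrite big1 ?addr0 // => a hab; rewrite ipZr he //.
by rewrite eq_sym (negPf (_ : (a : nat) != b)) ?mulr0.
Qed.

Lemma bessel k e A : orthonormal k e -> \sum_(a < k) ip (e a) A ^+ 2 <= ip A A.
Proof.
move=> he; rewrite -subr_ge0; have := ip_ge0 (A - proj k e A).
have h B : ip (proj k e A) B = \sum_(a < k) ip (e a) A * ip (e a) B.
  by rewrite ip_suml; apply: eq_bigr => a _; rewrite ipZl.
rewrite ipBl !ipBr (ipC A (proj _ _ _)) !h opprB.
have -> : \sum_(a < k) ip (e a) A * ip (e a) (proj k e A) =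
   \sum_(a < k) ip (e a) A * ip (e a) A.
  by apply: eq_bigr => a _; rewrite ip_proj.
by rewrite subrr addr0.
Qed.

(** Each |e a|^2 = 1 is the sum of its squared pairings with the 2 n^2
    coordinate matrices; exchanging the sums, Bessel's inequality bounds the
    contribution of each coordinate matrix by its squared norm 1. *)
Lemma orthonormal_size k e : orthonormal k e -> (k <= n * n * 2)%N.
Proof.
move=> he; rewrite -(ler_nat R).
have -> : k%:R = \sum_(a < k) ip (e a) (e a) :> R.
  under eq_bigr => a _ do rewrite he // eqxx.
  by rewrite sumr_const card_ord.
have -> : \sum_(a < k) ip (e a) (e a) = \sum_i \sum_j
   (\sum_(a < k) ip (e a) (delta_mx i j) ^+ 2
    + \sum_(a < k) ip (e a) ('i *: delta_mx i j) ^+ 2).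
  under eq_bigr do rewrite ipE.
  rewrite exchange_big; apply: eq_bigr => i _.
  rewrite exchange_big; apply: eq_bigr => j _.
  rewrite big_split; congr (_ + _); apply: eq_bigr => a _.
    by rewrite ipC ip_Re.
  by rewrite ipC ip_Im.
have h1 i j : ip (delta_mx i j : M) (delta_mx i j) = 1.
  by rewrite ip_Re mxE !eqxx.
have h2 i j : ip ('i *: delta_mx i j : M) ('i *: delta_mx i j) = 1.
  by rewrite ip_Im !mxE !eqxx mulr1.
have -> : (n * n * 2)%:R = \sum_(i < n) \sum_(j < n) 2 :> R.
  by rewrite !sumr_const !card_ord -!mulrnA mulnC.
apply: ler_sum => i _; apply: ler_sum => j _.
apply: lerD; first by rewrite -(h1 i j); exact: bessel.
by rewrite -(h2 i j); exact: bessel.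
Qed.

(** An orthonormal family in V that does not span V is enlarged by normalizing
    the residue of a vector outside its span; [orthonormal_size] stops the
    process. *)
Lemma orthonormal_basis_nat V : real_subspace V -> exists k e,
  [/\ orthonormal k e, forall a, (a < k)%N -> V (e a) &
      forall A, V A -> A = proj k e A].
Proof.
move=> hV.
(* d bounds the number of vectors that can still be added to e *)
suff ext d : forall k e, (n * n * 2 < k + d)%N -> orthonormal k e ->
   (forall a, (a < k)%N -> V (e a)) -> exists k e,
  [/\ orthonormal k e, forall a, (a < k)%N -> V (e a) &
      forall A, V A -> A = proj k e A].
  apply: (ext (n * n * 2).+1 0%N (fun=> 0)) => //.
elim: d => [|d IHd] k e hk he Ve.
  by have := orthonormal_size he; rewrite leqNgt -[k]addn0 hk.
have [h|] := pselect (forall A, V A -> A = proj k e A); first by exists k, e.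
move=> /existsNP[A /not_implyP[VA /eqP hA]].
pose B := A - proj k e A.
have VB : V B.
  apply: subspaceB => //; apply: subspace_sum => // a _.
  by apply: subspaceZ => //; exact: Ve.
have B0 : 0 < ip B B.
  rewrite lt_neqAle ip_ge0 andbT; apply/negP => /eqP /esym /ip_eq0 /eqP.
  by rewrite subr_eq0; exact/negP.
have eB a : (a < k)%N -> ip (e a) B = 0.
  by move=> ha; rewrite ipBr ip_proj // subrr.
pose r := Num.sqrt (ip B B).
have r0 : 0 < r by rewrite sqrtr_gt0.
pose e' a := if a == k then r^-1%:C *: B else e a.
apply: (IHd k.+1 e'); first by rewrite addSnnS.
  have ltk a : (a < k.+1)%N -> a != k -> (a < k)%N.
    by rewrite ltnS leq_eqVlt => /orP[/eqP ->|//]; rewrite eqxx.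
  move=> a b ha hb; rewrite /e'.
  have [ak|ak] := boolP (a == k); have [bk|bk] := boolP (b == k).
  - rewrite (eqP ak) (eqP bk) eqxx ipZl ipZr mulrA -expr2.
    rewrite -[X in _ * X](sqr_sqrtr (ip_ge0 B)).
    by rewrite -/r -exprMn mulVf ?expr1n ?gt_eqF.
  - by rewrite (eqP ak) ipZl ipC eB ?mulr0 ?ltk // eq_sym (negPf bk).
  - by rewrite (eqP bk) ipZr eB ?mulr0 ?ltk // (negPf ak).
  - by apply: he; exact: ltk.
move=> a; rewrite /e' ltnS leq_eqVlt; case: eqVneq => [_ _|_ /= ha].
  exact: subspaceZ.
exact: Ve.
Qed.

(** The dual vector has coordinates l (e a) in an orthonormal basis e of V. *)
Lemma sharpP V (l : M -> R) : real_subspace V ->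
  (forall t A B, V A -> V B -> l (t%:C *: A + B) = t * l A + l B) ->
  V (sharp V l) /\ forall A, V A -> ip (sharp V l) A = l A.
Proof.
move=> hV hl; rewrite /sharp; case: xgetP => [_ -> //|] /(_ _) h.
have [k [e [he Ve hp]]] := orthonormal_basis_nat hV.
have l0 : l 0 = 0.
  have := hl 1 0 0 (subspace0 hV) (subspace0 hV).
  rewrite scaler0 addr0 mul1r => /eqP.
  by rewrite -subr_eq0 opprD addrA subrr sub0r oppr_eq0 => /eqP.
case: (h (\sum_(a < k) (l (e a))%:C *: e a)); split.
  apply: subspace_sum => // a _; apply: subspaceZ => //; exact: Ve.
move=> A VA; rewrite {2}(hp A VA) ip_suml.
have -> : forall s : seq 'I_k, l (\sum_(a <- s) (ip (e a) A)%:C *: e a) =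
    \sum_(a <- s) ip (e a) A * l (e a).
  elim=> [|a s IHs]; first by rewrite !big_nil.
  rewrite !big_cons hl ?IHs //; first exact: Ve.
  by apply: subspace_sum => // b _; apply: subspaceZ => //; exact: Ve.
by apply: eq_bigr => a _; rewrite ipZl mulrC.
Qed.

Lemma orthprojP V A : real_subspace V ->
  V (orthproj V A) /\ forall B, V B -> ip (A - orthproj V A) B = 0.
Proof.
move=> hV; rewrite /orthproj; case: xgetP => [_ -> //|] /(_ _) h.
have [k [e [he Ve hp]]] := orthonormal_basis_nat hV.
case: (h (proj k e A)); split.
  apply: subspace_sum => // a _; apply: subspaceZ => //; exact: Ve.
move=> B VB; rewrite (hp B VB) ip_sumr big1 // => a _.
by rewrite ipZr [ip (_ - _) _]ipC ipBr ip_proj // subrr mulr0.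
Qed.

(** The hypothesis applies to the residue of A under orthogonal projection. *)
Lemma subspace_perp V A : real_subspace V ->
  (forall B, (forall C, V C -> ip B C = 0) -> ip B A = 0) -> V A.
Proof.
move=> hV h; have [VP hP] := orthprojP A hV.
suff -> : A = orthproj V A by [].
apply/eqP; rewrite -subr_eq0; apply/eqP/ip_eq0; rewrite ipBr (h _ hP).
by rewrite (hP _ VP) subrr.
Qed.

(** Functionals vanishing on V vanish along the curve, hence on its derivative. *)
Lemma subspace_mxderive V (c : R -> M) t B : real_subspace V ->
  (forall s, V (c s)) -> is_mxderive c t B -> V B.
Proof.
move=> hV Vc hc; apply: subspace_perp => // D hD.
have [_ <-] := hc D.
under eq_fun do rewrite hD //.
exact: derive_cst.
Qed.

End RealSubspaces.

(** * Direct sums, Lie algebras of matrix groups *)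

Section DirectSums.
Variables (R : realType) (n : nat).
Local Notation M := 'M[R[i]]_n.
Implicit Types (V A B : set M).

Lemma direct_sum2P V A B : direct_sum2 V A B ->
  [/\ real_subspace V, real_subspace A, real_subspace B &
      forall x, V x <-> exists a b, [/\ A a, B b & x = a + b]].
Proof.
move=> [hV hAB hx _]; have hA := hAB true I; have hB := hAB false I.
split=> // x; rewrite hx; split=> [[s [a [us has ->]]]|[a [b [Aa Bb ->]]]].
  exists (if true \in s then a true else 0), (if false \in s then a false else 0).
  split; first by case: ifP => [/has[]//|_]; exact: subspace0.
    by case: ifP => [/has[]//|_]; exact: subspace0.
  by rewrite big_uniq //= big_mkcond big_bool.
exists [:: true; false], (fun i : bool => if i then a else b); split=> //.
  by case.
by rewrite big_cons big_seq1.
Qed.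

Lemma direct_sum2I V A B : real_subspace V -> real_subspace A ->
  real_subspace B -> (forall x, V x <-> exists a b, [/\ A a, B b & x = a + b]) ->
  (forall a b, A a -> B b -> a + b = 0 -> a = 0 /\ b = 0) -> direct_sum2 V A B.
Proof.
move=> hV hA hB hx h0; split=> //; first by case.
  move=> x; rewrite hx; split=> [[a [b [Aa Bb ->]]]|[s [a [us has ->]]]].
    exists [:: true; false], (fun i : bool => if i then a else b); split=> //.
      by case.
    by rewrite big_cons big_seq1.
  exists (if true \in s then a true else 0), (if false \in s then a false else 0).
  split; first by case: ifP => [/has[]//|_]; exact: subspace0.
    by case: ifP => [/has[]//|_]; exact: subspace0.
  by rewrite big_uniq //= big_mkcond big_bool.
move=> s a us has s0.
have [ht hf] : (if true \in s then a true else 0) = 0 /\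
    (if false \in s then a false else 0) = 0.
  apply: h0.
  - by case: ifP => [/has[]//|_]; exact: subspace0.
  - by case: ifP => [/has[]//|_]; exact: subspace0.
  - by move: s0; rewrite big_uniq //= big_mkcond big_bool.
by case=> hi; [move: ht|move: hf]; rewrite hi.
Qed.

End DirectSums.

Section LieAlgebras.
Variables (R : realType) (n : nat).
Local Notation M := 'M[R[i]]_n.
Implicit Types (A B C E X Y : M) (U G H : set M) (t s : R).

Lemma lieZ H t A : lie H A -> lie H (t%:C *: A).
Proof. by move=> hA s; rewrite scalerA -rmorphM; exact: hA. Qed.

Lemma lie0 H : mx_subgroup H -> lie H 0.
Proof. by move=> [H1 _ _] t; rewrite scaler0 expm0. Qed.

Lemma lieN H A : lie H A -> lie H (- A).
Proof.
move=> hA; rewrite -scaleN1r.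
have -> : (-1 : R[i]) = (-1)%:C by rewrite rmorphN1.
exact: lieZ.
Qed.

Lemma lie_Ad H g A : mx_subgroup H -> H g -> lie H A -> lie H (adj_action g A).
Proof.
move=> [_ HM HV] Hg hA t; have [ug Hgi] := HV g Hg.
rewrite /adj_action -expm_conj //; exact (HM _ _ (HM _ _ Hg (hA t)) Hgi).
Qed.

(** The bracket is the derivative at 0 of t |-> Ad(exp(t A)) B, a curve in the
    Lie algebra. *)
Lemma lie_bracket H A B : mx_subgroup H -> real_subspace (lie H) ->
  lie H A -> lie H B -> lie H (lie_ad A B).
Proof.
move=> hH hl hA hB.
apply: (subspace_mxderive hl _ (is_mxderive_Ad A B)) => s.
by apply: lie_Ad.
Qed.

Lemma unitary_ctr A : A \is unitarymx -> A *m ctr A = 1%:M.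
Proof. by move=> /unitarymxP. Qed.

(** Derivative at 0 of exp(t A) exp(t A)^* = 1. *)
Lemma lie_unitary_skew U A : U `<=` [set A : M | A \is unitarymx] ->
  lie U A -> ctr A = - A.
Proof.
move=> hU hA.
have d := is_mxderiveM (is_mxderive_expm A 0) (is_mxderive_ctr (is_mxderive_expm A 0)).
have d' : is_mxderive (fun t => expm (t%:C *: A) *m ctr (expm (t%:C *: A))) 0 0.
  rewrite (_ : (fun t => _) = fun=> 1%:M); first exact: is_mxderive_cst.
  by apply/funext => t; apply: unitary_ctr; apply: hU; exact: hA.
have := is_mxderive_unique d d'; rewrite ctrM scale0r expm0 ctr1 !mulmx1 !mul1mx.
by move=> h; apply/eqP; rewrite -addr_eq0 addrC h.
Qed.

Lemma expm_skew_ctr A t : ctr A = - A ->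
  ctr (expm (t%:C *: A)) = expm ((- t)%:C *: A).
Proof. by move=> hA; rewrite expm_ctr hA scalerN -scaleNr rmorphN. Qed.

Lemma cauchy_schwarz A B : `|ip A B| <= Num.sqrt (ip A A * ip B B).
Proof.
rewrite -sqrtr_sqr; apply: ler_wsqrtr.
have [B0|B0] := eqVneq (ip B B) 0.
  by rewrite (ip_eq0 B0) !ip0r expr0n mulr0.
have B_gt0 : 0 < ip B B by rewrite lt_neqAle eq_sym B0 ip_ge0.
have := ip_ge0 (A - (ip A B / ip B B)%:C *: B).
rewrite ipBl !ipBr !ipZl !ipZr (ipC B A).
rewrite divfK // subrr subr0 subr_ge0 mulrAC -expr2 ler_pdivrMr //.
Qed.

Definition unitary A := A *m ctr A = 1%:M.

Lemma unitary_ctrl A : unitary A -> ctr A *m A = 1%:M.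
Proof. exact: mulmx1C. Qed.

Lemma unitaryX A k : unitary A -> unitary (A ^+ k).
Proof.
move=> hA; elim: k => [|k IHk]; first by rewrite /unitary expr0 ctr1 mulmx1.
rewrite /unitary exprS -[A * _]/(A *m _) ctrM mulmxA -[A *m _ *m _]mulmxA.
by rewrite IHk mulmx1.
Qed.

(** Telescoping A^k - B^k into k terms A^j (A - B) B^(k-1-j), whose norm is
    that of A - B since the outer factors are unitary. *)
Lemma unitary_pow_dist A B E k : unitary A -> unitary B ->
  `|ip E (A ^+ k - B ^+ k)| <= k%:R * Num.sqrt (ip E E * ip (A - B) (A - B)).
Proof.
move=> hA hB; elim: k E => [|k IHk] E.
  by rewrite !expr0 subrr ip0r normr0 mul0r.
have h (X Y : M) (r : R) : unitary Y -> `|ip (ctr A *m E) X| <= r ->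
    `|ip E (A *m X + (A - B) *m Y)| <=
    r + Num.sqrt (ip E E * ip (A - B) (A - B)).
  move=> hY hX; rewrite (ipDr E) (ip_adjl E X) (ip_adjr E (A - B)).
  apply: le_trans (ler_normD _ _) _; apply: lerD => //.
  apply: le_trans (cauchy_schwarz _ _) _.
  by rewrite ip_adjr ctrK -mulmxA unitary_ctrl // mulmx1.
have -> : A ^+ k.+1 - B ^+ k.+1 = A *m (A ^+ k - B ^+ k) + (A - B) *m B ^+ k.
  by rewrite mulmxBr mulmxBl addrA subrK !exprS.
rewrite -natr1 mulrDl mul1r; apply: h; first exact: unitaryX.
apply: le_trans (IHk _) _; rewrite ip_adjl ctrK mulmxA.
by rewrite hA mul1mx.
Qed.

End LieAlgebras.

(** * The Lie algebra of a closed unitary group *)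

Section UnitaryLie.
Variables (R : realType) (n : nat).
Local Notation M := 'M[R[i]]_n.
Implicit Types (A B C E X Y : M) (U G H : set M) (t s : R).

Lemma is_derive0_seq (f : R -> R) : f 0 = 0 -> is_derive (0 : R) (1 : R) f 0 ->
  k.+1%:R * f k.+1%:R^-1 @[k --> \oo] --> (0 : R).
Proof.
move=> f0 [df f'0].
have h : h^-1 * f h @[h --> 0^'] --> (0 : R).
  suff : h^-1 * f h @[h --> 0^'] --> 'D_1 f 0 by rewrite f'0.
  move: df; rewrite /derivable /derive f0.
  have -> // : (fun h : R => h^-1 *: ((f \o shift 0) (h *: (1 : R)) - 0)) =
    (fun h => h^-1 * f h).
  apply/funext => x; rewrite subr0 /= addr0.
  by rewrite -[x *: 1]/(x * 1) mulr1.
have /cvg_at_rightP := cvg_dnbhs_at_right h.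
move=> /(_ (fun k => k.+1%:R^-1)); rewrite /= => hk.
have := hk (conj (fun k => _) cvg_harmonic).
under eq_fun do rewrite invrK; apply => k.
by rewrite invr_gt0 ltr0n.
Qed.

Lemma expm_natX A k t : expm (t%:C *: A) ^+ k = expm ((k%:R * t)%:C *: A).
Proof.
elim: k => [|k IHk]; first by rewrite expr0 mul0r scale0r expm0.
have -> : k.+1%:R * t = t + k%:R * t by rewrite -natr1 addrC mulrDl mul1r.
by rewrite expmD exprS IHk.
Qed.

Lemma expm_root A k : expm ((k.+1%:R^-1 : R)%:C *: A) ^+ k.+1 = expm A.
Proof.
rewrite expm_natX; have -> : k.+1%:R * k.+1%:R^-1 = 1 :> R.
  by rewrite mulfV // pnatr_eq0.
congr expm; exact: scale1r.
Qed.

Lemma subgroupX U A k : mx_subgroup U -> U A -> U (A ^+ k).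
Proof.
move=> [U1 UM _] UA; elim: k => [|k IHk]; first by rewrite expr0.
by rewrite exprS; apply: UM.
Qed.

Lemma expm_skew_unitary A t : ctr A = - A -> unitary (expm (t%:C *: A)).
Proof. by move=> hA; rewrite /unitary expm_skew_ctr // expmN. Qed.

(** Trotter's product formula: with h = 1/(k+1), the elements
    (exp(h A) exp(h B))^(k+1) of U converge to exp(A + B). The curves
    c s = exp(s A) exp(s B) and d s = exp(s (A + B)) agree to first order at 0,
    so (k+1) |c h - d h| tends to 0, which by [unitary_pow_dist] dominates
    the difference between c(h)^(k+1) and d(h)^(k+1) = exp(A + B). *)
Lemma closed_unitary_expmD U A B : mx_subgroup U ->
  U `<=` [set A : M | A \is unitarymx] ->
  closed U -> lie U A -> lie U B -> U (expm (A + B)).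
Proof.
move=> hU uU cU hA hB.
have sA := lie_unitary_skew uU hA; have sB := lie_unitary_skew uU hB.
have sAB : ctr (A + B) = - (A + B) by rewrite ctrD sA sB opprD.
pose c s := expm (s%:C *: A) *m expm (s%:C *: B).
pose d s := expm (s%:C *: (A + B)).
have hg : is_mxderive (fun s => c s - d s) 0 0.
  have h := is_mxderiveD (is_mxderiveM (is_mxderive_expm A 0)
    (is_mxderive_expm B 0)) (is_mxderiveN (is_mxderive_expm (A + B) 0)).
  apply: is_mxderive_eq h _.
  by rewrite !scale0r !expm0 !mulmx1 mul1mx subrr.
have g0 : c 0 - d 0 = 0 by rewrite /c /d !scale0r !expm0 mulmx1 subrr.
pose h k : R := k.+1%:R^-1.
have hE E : k.+1%:R * ip E (c (h k) - d (h k)) @[k --> \oo] --> (0 : R).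
  apply: (is_derive0_seq (f := fun s => ip E (c s - d s))).
    by rewrite g0 ip0r.
  by have := hg E; rewrite ip0r.
(* first-order agreement of c and d, summed over the real coordinates *)
have hN : k.+1%:R ^+ 2 * ip (c (h k) - d (h k)) (c (h k) - d (h k))
    @[k --> \oo] --> (0 : R).
  have -> : (fun k => k.+1%:R ^+ 2 * ip (c (h k) - d (h k)) (c (h k) - d (h k)))
    = (fun k => \sum_i \sum_j
       (k.+1%:R * ip (delta_mx i j) (c (h k) - d (h k)) *
        (k.+1%:R * ip (delta_mx i j) (c (h k) - d (h k))) +
       (k.+1%:R * ip ('i *: delta_mx i j) (c (h k) - d (h k)) *
        (k.+1%:R * ip ('i *: delta_mx i j) (c (h k) - d (h k)))))).
    apply/funext => k; rewrite ipE mulr_sumr; apply: eq_bigr => i _.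
    rewrite mulr_sumr; apply: eq_bigr => j _.
    by rewrite !ip_Re !ip_Im mulrDr expr2 !mulrA; congr (_ + _);
      rewrite [X in X * _]mulrAC.
  have z : \sum_(i < n) \sum_(j < n) (0 * 0 + 0 * 0 : R) = 0.
    by rewrite !mulr0 addr0 big1 // => i _; rewrite big1.
  rewrite -[X in _ --> X]z.
  apply: cvg_big => [|i _]; first by move=> x; apply: add_continuous.
  apply: cvg_big => [|j _]; first by move=> x; apply: add_continuous.
  by apply: cvgD; apply: cvgM; exact: hE.
have hV E : ip E (c (h k) ^+ k.+1) @[k --> \oo] --> ip E (expm (A + B)).
  apply: cvg_sub0 (cvg_cst (ip E (expm (A + B)))).
  apply/norm_cvg0P.
  have hs : Num.sqrt (ip E E * (k.+1%:R ^+ 2 *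
      ip (c (h k) - d (h k)) (c (h k) - d (h k)))) @[k --> \oo] --> (0 : R).
    have -> : (0 : R) = Num.sqrt (ip E E * 0) by rewrite mulr0 sqrtr0.
    apply: continuous_cvg; first exact: sqrt_continuous.
    by apply: cvgM hN; exact: cvg_cst.
  apply: squeeze_cvgr _ (cvg_cst 0) hs.
  near=> k; rewrite normr_ge0 /=.
  have <- : d (h k) ^+ k.+1 = expm (A + B).
    exact: expm_root.
  have uc : unitary (c (h k)).
    by apply: unitary_ctr; apply: uU; case: hU => _ UM _; exact: UM.
  have := unitary_pow_dist E k.+1 uc (expm_skew_unitary (h k) sAB).
  rewrite (ipBr E) => /le_trans; apply.
  have gen (x y w : R) : 0 <= w -> w * Num.sqrt (x * y) <= Num.sqrt (x * (w ^+ 2 * y)).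
    move=> w0; rewrite -{1}(ger0_norm w0) -sqrtr_sqr -sqrtrM ?sqr_ge0 //.
    by rewrite mulrCA.
  exact: gen.
apply: (@closed_cvg _ _ eventually _ (fun k => c (h k) ^+ k.+1 : M) U cU _
  (expm (A + B))).
  near=> k; apply: subgroupX => //.
  by case: hU => _ UM _; exact: UM.
apply: cvg_mx_entries => i j; apply: cvg_complex.
  by rewrite -ip_Re; under eq_fun do rewrite -ip_Re; exact: hV.
by rewrite -ip_Im; under eq_fun do rewrite -ip_Im; exact: hV.
Unshelve. all: by end_near. Qed.

Lemma lie_unitary_subspace U : mx_subgroup U ->
  U `<=` [set A : M | A \is unitarymx] -> closed U -> real_subspace (lie U).
Proof.
move=> hU uU cU; split; first exact: lie0.
move=> t A B hA hB s; rewrite scalerDr.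
exact (closed_unitary_expmD hU uU cU (lieZ s (lieZ t hA)) (lieZ s hB)).
Qed.

End UnitaryLie.

(** * The Cartan decomposition of a compatible subgroup *)

Section CompatibleSubgroup.
Variables (R : realType) (n : nat) (U G : set 'M[R[i]]_n).
Hypotheses (hU : compact_connected_unitary_group U) (hG : real_compatible U G).
Local Notation M := 'M[R[i]]_n.
Local Notation k := (lie (Kgrp U G)).
Local Notation p := (palg U G).
Implicit Types (A B C E xi eta : M) (t : R).

Lemma U_group : mx_subgroup U. Proof. by case: hU. Qed.
Lemma G_group : mx_subgroup G. Proof. by case: hG. Qed.

Lemma lieU_subspace : real_subspace (lie U).
Proof.
case: hU => hUg uU cU _; apply: lie_unitary_subspace => //.
by apply: compact_closed cU; exact: norm_hausdorff.
Qed.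

Lemma itimes_subspace (V : set M) : real_subspace V -> real_subspace (itimes V).
Proof.
move=> hV; split; first by exists 0; [exact: subspace0 | rewrite scaler0].
move=> t _ _ [A VA <-] [B VB <-]; exists (t%:C *: A + B).
  by apply: subspaceD => //; exact: subspaceZ.
by rewrite scalerDr !scalerA mulrC.
Qed.

Lemma lieG_subspace : real_subspace (lie G).
Proof. by case: hG => _ _ _ /direct_sum2P[]. Qed.
Lemma k_subspace : real_subspace k.
Proof. by case: hG => _ _ _ /direct_sum2P[]. Qed.
Lemma p_subspace : real_subspace p.
Proof. by case: hG => _ _ _ /direct_sum2P[]. Qed.

Lemma lieG_decomp xi : lie G xi <-> exists a b, [/\ k a, p b & xi = a + b].
Proof. by case: hG => _ _ _ /direct_sum2P[_ _ _]; apply. Qed.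

Lemma k_lieU A : k A -> lie U A.
Proof. by move=> h t; case: (h t). Qed.
Lemma k_lieG A : k A -> lie G A.
Proof. by move=> h t; case: (h t). Qed.
Lemma p_lieG A : p A -> lie G A.
Proof. by case. Qed.
Lemma p_itimes A : p A -> itimes (lie U) A.
Proof. by case. Qed.

Lemma scale_i_i A : 'i *: ('i *: A) = - A.
Proof. by rewrite scalerA -expr2 sqrCi scaleN1r. Qed.

Lemma itimes_lieU A : itimes (lie U) A -> lie U ('i *: A).
Proof. by case=> B hB <-; rewrite scale_i_i; exact: lieN. Qed.

Lemma lieU_skew A : lie U A -> ctr A = - A.
Proof. by apply: lie_unitary_skew; case: hU. Qed.
Lemma k_skew A : k A -> ctr A = - A.
Proof. by move=> /k_lieU; exact: lieU_skew. Qed.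
Lemma p_herm A : p A -> ctr A = A.
Proof.
by move=> /p_itimes[B hB <-]; rewrite ctrZi (lieU_skew hB) scalerN opprK.
Qed.

Lemma skew_herm_eq0 A : ctr A = - A -> ctr A = A -> A = 0.
Proof.
move=> -> h; apply: ip_eq0; have : ip A A = - ip A A by rewrite -{1}h ipNl.
by move/eqP; rewrite -addr_eq0 -mulr2n mulrn_eq0 => /eqP.
Qed.

(** In lie G = k + p the first component is skew-Hermitian and the second one
    Hermitian, so the Hermitian component of a skew-Hermitian element is 0. *)
Lemma lieG_skew xi : lie G xi -> ctr xi = - xi -> k xi.
Proof.
move=> /lieG_decomp[a [b [ka pb ->]]].
rewrite ctrD (k_skew ka) (p_herm pb) opprD => /addrI hb.
by rewrite (skew_herm_eq0 _ (p_herm pb)) ?addr0 // (p_herm pb).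
Qed.

Lemma lieG_herm xi : lie G xi -> ctr xi = xi -> p xi.
Proof.
move=> /lieG_decomp[a [b [ka pb ->]]].
rewrite ctrD (k_skew ka) (p_herm pb) => /addIr ha.
by rewrite (skew_herm_eq0 (k_skew ka)) ?add0r // (k_skew ka).
Qed.

Lemma ctr_bracket A B : ctr (lie_ad A B) = lie_ad (ctr B) (ctr A).
Proof. by rewrite /lie_ad ctrB !ctrM. Qed.

Lemma lie_adNl A B : lie_ad (- A) B = - lie_ad A B.
Proof. by rewrite /lie_ad mulNmx mulmxN opprB opprK addrC. Qed.
Lemma lie_adNr A B : lie_ad A (- B) = - lie_ad A B.
Proof. by rewrite /lie_ad mulNmx mulmxN opprB opprK addrC. Qed.
Lemma lie_adC A B : lie_ad A B = - lie_ad B A.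
Proof. by rewrite /lie_ad opprB. Qed.
Lemma lie_adDl A B C : lie_ad (A + B) C = lie_ad A C + lie_ad B C.
Proof. by rewrite /lie_ad mulmxDl mulmxDr opprD addrACA. Qed.
Lemma lie_adDr A B C : lie_ad A (B + C) = lie_ad A B + lie_ad A C.
Proof. by rewrite lie_adC lie_adDl opprD -!lie_adC. Qed.
Lemma lie_adZr (c : R[i]) A B : lie_ad A (c *: B) = c *: lie_ad A B.
Proof. by rewrite /lie_ad -scalemxAl -scalemxAr scalerBr. Qed.
Lemma lie_ad0r A : lie_ad A 0 = 0.
Proof. by rewrite /lie_ad mulmx0 mul0mx subrr. Qed.

Lemma lie_ad_centralizer A B C :
  lie_ad A C = 0 -> lie_ad B C = 0 -> lie_ad (lie_ad A B) C = 0.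
Proof.
rewrite /lie_ad => /subr0_eq hA /subr0_eq hB.
rewrite mulmxBl mulmxBr -!mulmxA hA hB !mulmxA hA hB.
by rewrite subrr.
Qed.

Lemma lieG_bracket A B : lie G A -> lie G B -> lie G (lie_ad A B).
Proof. by apply: lie_bracket; [exact: G_group | exact: lieG_subspace]. Qed.

Lemma kp_bracket A B : k A -> p B -> p (lie_ad A B).
Proof.
move=> kA pB; apply: lieG_herm.
  by apply: lieG_bracket; [exact: k_lieG | exact: p_lieG].
by rewrite ctr_bracket (k_skew kA) (p_herm pB) lie_adNr -lie_adC.
Qed.

Lemma pk_bracket A B : p A -> k B -> p (lie_ad A B).
Proof.
by move=> pA kB; rewrite lie_adC; apply: (subspaceN p_subspace); exact: kp_bracket.
Qed.

Lemma pp_bracket A B : p A -> p B -> k (lie_ad A B).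
Proof.
move=> pA pB; apply: lieG_skew.
  by apply: lieG_bracket; exact: p_lieG.
by rewrite ctr_bracket (p_herm pA) (p_herm pB) lie_adC.
Qed.

Lemma ip_ad_herm A B C : ctr A = A -> ip (lie_ad A B) C = ip B (lie_ad A C).
Proof.
move=> hA; rewrite /lie_ad ipBl ipBr [ip (A *m B) _]ip_mull.
by rewrite [ip (B *m A) _]ip_mulr hA.
Qed.

Lemma ip_ad_skew A B C : ctr A = - A -> ip (lie_ad A B) C = - ip B (lie_ad A C).
Proof.
move=> hA; rewrite /lie_ad ipBl ipBr [ip (A *m B) _]ip_mull [ip (B *m A) _]ip_mulr hA.
by rewrite mulNmx mulmxN !ipNr opprB opprK addrC.
Qed.

Lemma adj_actionZ (c : R[i]) g A : adj_action g (c *: A) = c *: adj_action g A.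
Proof. by rewrite /adj_action -scalemxAr -scalemxAl. Qed.

Lemma p_Ad g A : Kgrp U G g -> p A -> p (adj_action g A).
Proof.
move=> [Gg Ug] [lA [B hB hBA]]; split; first exact: lie_Ad G_group Gg lA.
exists (adj_action g B); first exact: lie_Ad U_group Ug hB.
by rewrite -adj_actionZ hBA.
Qed.

Lemma G_UC : G `<=` complexified_group U.
Proof. by case: hG => _ [C _ ->] _ _ g []. Qed.

Lemma lieU_complexified A : lie U A -> complexified_lie U A.
Proof.
move=> hA; exists A => //; exists 0; first exact: lie0 U_group.
by rewrite scaler0 addr0.
Qed.

Lemma lieG_complexified A : lie G A -> complexified_lie U A.
Proof.
move=> /lieG_decomp[a [b [ka /p_itimes[c hc <-] ->]]].
by exists a; [exact: k_lieU | exists c].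
Qed.

End CompatibleSubgroup.

(** * Fundamental vectors as differentials *)

Section OneVariableCalculus.
Variables (R : realType).
Implicit Types (V W : normedModType R).

Lemma is_derive_chain V W (f : V -> W) (c : R -> V) t v :
  is_derive t (1 : R) c v -> differentiable f (c t) ->
  is_derive t (1 : R) (fun s => f (c s)) ('d f (c t) v).
Proof.
move=> [dc <-] df.
have dc' : differentiable c t by apply/derivable1_diffP.
have dfc : differentiable (f \o c) t by exact: differentiable_comp.
apply: DeriveDef; first by apply/derivable1_diffP.
by rewrite [LHS](deriveE _ dfc) diff_comp // deriveE.
Qed.

Lemma is_derive_line V W (f : V -> W) a v : differentiable f a ->
  is_derive (0 : R) (1 : R) (fun t : R => f (a + t *: v)) ('d f a v).
Proof.
move=> df; have h : is_derive (0 : R) (1 : R) (fun t : R => a + t *: v) v.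
  have -> : (fun t : R => a + t *: v) = cst a + (fun t : R => t *: v) by [].
  rewrite -[X in is_derive _ _ _ X]add0r; apply: is_deriveD.
  apply: DeriveDef; first by apply/derivable1_diffP; exact: differentiableZl.
  rewrite deriveE; last exact: differentiableZl.
  rewrite (@diffZl _ _ _ (fun t : R => t)) //.
  by rewrite diff_val scale1r.
have e : a + 0 *: v = a by rewrite scale0r addr0.
have df' : differentiable f (a + 0 *: v) by rewrite e.
by have := is_derive_chain h df'; rewrite e.
Qed.

Lemma is_derive_entry p q (c : R -> 'M[R]_(p, q)) t v i j :
  is_derive t (1 : R) c v -> is_derive t (1 : R) (fun s => c s i j) (v i j).
Proof.
move=> [dc <-]; apply: DeriveDef; first by move/derivable_mxP: dc.
by rewrite derive_mx // mxE.
Qed.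

Lemma is_derive_mx p q (c : R -> 'M[R]_(p, q)) t (v : 'M[R]_(p, q)) :
  (forall i j, is_derive t (1 : R) (fun s => c s i j) (v i j)) ->
  is_derive t (1 : R) c v.
Proof.
move=> h; have dc : derivable c t 1 by apply/derivable_mxP => i j; case: (h i j).
apply: DeriveDef => //; rewrite derive_mx //.
by apply/matrixP => i j; rewrite mxE; case: (h i j).
Qed.

Lemma is_derive_unique V (c : R -> V) t v w :
  is_derive t (1 : R) c v -> is_derive t (1 : R) c w -> v = w.
Proof. by move=> [_ <-] [_ <-]. Qed.

End OneVariableCalculus.

Section ActionCalculus.
Variables (R : realType) (n m : nat) (Z : complexManifold R m).
Variables (U : set 'M[R[i]]_n) (act : 'M[R[i]]_n -> Z -> Z).
Local Notation M := 'M[R[i]]_n.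
Local Notation UC := (complexified_group U).
Local Notation uC := (complexified_lie U).
Hypotheses (hU : mx_subgroup U) (hact : holomorphic_action U act).
Implicit Types (A B xi eta : M) (i j : cm_index Z) (z : Z) (t s : R).

Lemma UC1 : UC 1%:M.
Proof.
exists 0; first exact: lie0.
by exists 1%:M; [case: hU | rewrite scaler0 expm0 mul1mx].
Qed.

Definition real_vec d (x : 'I_d -> R) : cspace R d := row_mx (\row_a x a) 0.

Lemma ccoord_real d (x : 'I_d -> R) a : ccoord (real_vec x) a = (x a)%:C.
Proof. by rewrite /ccoord /real_vec row_mxKl row_mxKr !mxE. Qed.

Lemma ccoord_cJ d (v : cspace R d) a : ccoord (cJ v) a = 'i * ccoord v a.
Proof.
rewrite /ccoord /cJ row_mxKl row_mxKr mxE.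
by apply/eqP; rewrite eq_complex /= !mul0r !mul1r sub0r add0r !eqxx.
Qed.

Lemma ccoordZ d t (v : cspace R d) a : ccoord (t *: v) a = t%:C * ccoord v a.
Proof.
rewrite /ccoord !linearZ !mxE /=.
by apply/eqP; rewrite eq_complex /= !mul0r subr0 addr0 !eqxx.
Qed.

(** The action near g, read in one chart on both sides and in the coordinates
    xi |-> exp(xi) g of the group. *)
Definition chart_action d (xi : 'I_d -> M) (g : M) i
    (p : (cspace R d * cspace R m)%type) : cspace R m :=
  phi i (act (expm (\sum_a ccoord p.1 a *: xi a) *m g) (psi i p.2)).

Lemma chart_action0 d (xi : 'I_d -> M) g i v :
  chart_action xi g i (0, v) = phi i (act g (psi i v)).
Proof.
rewrite /chart_action big1 /= => [|a _]; first by rewrite expm0 mul1mx.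
by rewrite /ccoord !linear0 !mxE scale0r.
Qed.

Lemma chart_action_hol d (xi : 'I_d -> M) g i z :
  (forall a, uC (xi a)) -> UC g -> dom i z -> dom i (act g z) ->
  differentiable (chart_action xi g i) (0, phi i z) /\
  forall v, 'd (chart_action xi g i) (0, phi i z) (prodJ v) =
            cJ ('d (chart_action xi g i) (0, phi i z) v).
Proof.
move=> hxi hg iz igz; case: hact => _ _ /(_ d xi g i i hxi hg) [sm hol].
have D0 : cdom i (0 : cspace R d, phi i z).2 /\
    dom i (act (expm (\sum_a ccoord (0 : cspace R d, phi i z).1 a *: xi a) *m g)
      (psi i (0 : cspace R d, phi i z).2)).
  split; first by exists z.
  rewrite big1 /= => [|a _]; first by rewrite expm0 mul1mx phiK.
  by rewrite /ccoord !linear0 !mxE scale0r.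
split; first by case: (sm 1%N) => h _; exact: h.
by move=> v; exact: hol.
Qed.

Lemma act1 z : act 1%:M z = z.
Proof. by case: hact => -[h _] _ _; exact: h. Qed.

Lemma actM g h z : UC g -> UC h -> act (g *m h) z = act g (act h z).
Proof. by case: hact => -[_ h'] _ _; exact: h'. Qed.

Lemma is_derive_flow d (xi : 'I_d -> M) (v : cspace R d) i z :
  (forall a, uC (xi a)) -> dom i z ->
  is_derive (0 : R) (1 : R)
    (fun t => phi i (act (expm (t%:C *: (\sum_a ccoord v a *: xi a))) z))
    ('d (chart_action xi 1%:M i) (0, phi i z) (v, 0)).
Proof.
move=> hxi iz; have i1z : dom i (act 1%:M z) by rewrite act1.
have [df _] := chart_action_hol hxi UC1 iz i1z.
have := is_derive_line (v, 0) df.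
rewrite (_ : (fun t : R => _) =
  (fun t => phi i (act (expm (t%:C *: (\sum_a ccoord v a *: xi a))) z))) //.
apply/funext => t; rewrite /chart_action /= scaler0 addr0 add0r phiK // mulmx1.
rewrite scaler_sumr; congr (phi i (act (expm _) z)).
by apply: eq_bigr => a _; rewrite ccoordZ scalerA.
Qed.

(** The fundamental vector of a combination of the xi a is the value, at the
    coefficients, of a single differential. This is what makes it depend
    linearly, and even complex linearly, on the Lie algebra element. *)
Lemma fund_vecE d (xi : 'I_d -> M) (v : cspace R d) i z :
  (forall a, uC (xi a)) -> dom i z ->
  fund_vec act i (\sum_a ccoord v a *: xi a) z =
  'd (chart_action xi 1%:M i) (0, phi i z) (v, 0).
Proof.
move=> hxi iz; rewrite /fund_vec derive1E.
by have [_ ->] := is_derive_flow v hxi iz.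
Qed.

Lemma fund_vecP xi i z : uC xi -> dom i z ->
  is_derive (0 : R) (1 : R) (fun t => phi i (act (expm (t%:C *: xi)) z))
    (fund_vec act i xi z).
Proof.
move=> hxi iz.
have e : \sum_(a < 1) ccoord (real_vec (fun=> 1)) a *: xi = xi.
  by rewrite big_ord1 ccoord_real scale1r.
have := is_derive_flow (d := 1) (xi := fun=> xi) (real_vec (fun=> 1)) (fun=> hxi) iz.
have E := fund_vecE (d := 1) (xi := fun=> xi) (real_vec (fun=> 1)) (fun=> hxi) iz.
by rewrite -E e.
Qed.

(** Two directions are enough: both sides are values of the differential of
    [chart_action] for the pair (xi, eta). *)
Lemma fund_vecD xi eta i z t : uC xi -> uC eta -> dom i z ->
  fund_vec act i (t%:C *: xi + eta) z =
  t *: fund_vec act i xi z + fund_vec act i eta z.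
Proof.
move=> hxi heta iz.
pose e (a : 'I_2) := if a == ord0 then xi else eta.
have he a : uC (e a) by rewrite /e; case: ifP.
have E (x : 'I_2 -> R) : \sum_a ccoord (real_vec x) a *: e a =
    (x ord0)%:C *: xi + (x (lift ord0 ord0))%:C *: eta.
  by rewrite big_ord_recl big_ord1 !ccoord_real.
pose v0 : 'I_2 -> R := fun a => (a == ord0)%:R.
pose v1 : 'I_2 -> R := fun a => (a != ord0)%:R.
pose v : 'I_2 -> R := fun a => if a == ord0 then t else 1.
have -> : t%:C *: xi + eta = \sum_a ccoord (real_vec v) a *: e a.
  by rewrite E /v /= scale1r.
have h0 : \sum_a ccoord (real_vec v0) a *: e a = xi.
  by rewrite E /v0 /= scale1r scale0r addr0.
have h1 : \sum_a ccoord (real_vec v1) a *: e a = eta.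
  by rewrite E /v1 /= scale1r scale0r add0r.
rewrite -[in X in t *: X]h0 -[in X in _ + X]h1 !fund_vecE //.
rewrite -linearZ -linearD /=; congr ('d _ _ _).
rewrite -[RHS]/(t *: real_vec v0 + real_vec v1, t *: 0 + 0) scaler0 addr0.
congr (_, _).
rewrite /real_vec scale_row_mx add_row_mx scaler0 addr0; congr row_mx.
apply/rowP => a; rewrite !mxE /v /v0 /v1.
by case: eqP => _; rewrite ?mulr1 ?mulr0 ?addr0 ?add0r.
Qed.

(** Multiplying xi by i multiplies its complex coordinate by i, and the
    differential of [chart_action] commutes with the complex structures. *)
Lemma fund_veci xi i z : uC xi -> dom i z ->
  fund_vec act i ('i *: xi) z = cJ (fund_vec act i xi z).
Proof.
move=> hxi iz.
pose r : cspace R 1 := real_vec (fun=> 1).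
have e : \sum_(a < 1) ccoord r a *: xi = xi.
  by rewrite big_ord1 ccoord_real scale1r.
have ei : \sum_(a < 1) ccoord (cJ r) a *: xi = 'i *: xi.
  by rewrite big_ord1 ccoord_cJ ccoord_real mulr1.
have E := fund_vecE (d := 1) (xi := fun=> xi) _ (fun=> hxi) iz.
rewrite -{1}ei -{2}e !E.
have i1z : dom i (act 1%:M z) by rewrite act1.
have [_ <-] := chart_action_hol (d := 1) (xi := fun=> xi) (fun=> hxi) UC1 iz i1z.
congr ('d _ _ _); rewrite /prodJ /=; congr (_, _).
by rewrite /cJ !linear0 row_mx0.
Qed.

End ActionCalculus.

(** * Flows and stabilizers *)

Lemma is_derive_chain_at (R : realType) (V W : normedModType R) (f : V -> W)
    (c : R -> V) t v a : is_derive t (1 : R) c v -> c t = a ->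
  differentiable f a -> is_derive t (1 : R) (fun s => f (c s)) ('d f a v).
Proof. by move=> hc <-; exact: is_derive_chain. Qed.

Section Stabilizers.
Variables (R : realType) (n m : nat) (Z : complexManifold R m).
Variables (U : set 'M[R[i]]_n) (act : 'M[R[i]]_n -> Z -> Z).
Local Notation M := 'M[R[i]]_n.
Local Notation UC := (complexified_group U).
Local Notation uC := (complexified_lie U).
Hypotheses (hU : mx_subgroup U) (hact : holomorphic_action U act).
Implicit Types (A B xi eta : M) (i j : cm_index Z) (z : Z) (t s : R).

Lemma phi_inj i z z' : dom i z -> dom i z' -> phi i z = phi i z' -> z = z'.
Proof. by move=> iz iz' h; rewrite -(phiK iz) h phiK. Qed.

Lemma flow_continuous xi z : (forall t, UC (expm (t%:C *: xi))) ->
  continuous (fun t : R => act (expm (t%:C *: xi)) z).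
Proof.
move=> hxi t; case: hact => _ /subspace_continuousP hc _.
have h0 := hc (expm (t%:C *: xi), z) (conj (hxi t) I).
have hg : (expm (s%:C *: xi), z) @[s --> t] --> (expm (t%:C *: xi), z).
  move=> P [[P1 P2] [/= h1 h2] hP].
  have h3 : nbhs t (fun s => P1 (expm (s%:C *: xi))) := expm_continuous h1.
  suff : nbhs t (fun s => P (expm (s%:C *: xi), z)) by [].
  by apply: filterS h3 => s hs; apply: hP; split => //=; exact: nbhs_singleton.
have hw : (expm (s%:C *: xi), z) @[s --> t] -->
    within (UC `*` [set: Z]) (nbhs (expm (t%:C *: xi), z)).
  move=> P hP; have h3 : nbhs t (fun s => (UC `*` [set: Z]) (expm (s%:C *: xi), z) ->
    P (expm (s%:C *: xi), z)) := hg _ hP.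
  suff : nbhs t (fun s => P (expm (s%:C *: xi), z)) by [].
  by apply: filterS h3 => s /=; apply.
exact: (cvg_comp _ _ hw h0).
Qed.

Lemma flow_near_dom xi i z t : (forall t, UC (expm (t%:C *: xi))) ->
  dom i (act (expm (t%:C *: xi)) z) ->
  \forall s \near t, dom i (act (expm (s%:C *: xi)) z).
Proof.
move=> hxi hi; apply: (flow_continuous (z := z) hxi).
exact: open_nbhs_nbhs (conj (dom_open i) hi).
Qed.

(** This is [chart_action] with no Lie algebra direction. *)
Lemma chart_map_differentiable g i z : UC g -> dom i z -> dom i (act g z) ->
  differentiable (fun v => phi i (act g (psi i v))) (phi i z).
Proof.
move=> hg iz igz.
have [df _] := chart_action_hol (d := 0) (xi := fun=> 0) hact
  (fun a => match a with Ordinal _ h => match notF h with end end) hg iz igz.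
have -> : (fun v => phi i (act g (psi i v))) =
    chart_action (d := 0) act (fun=> 0) g i \o (fun v => (0, v)).
  by apply/funext => v; rewrite /= chart_action0.
exact: differentiable_comp.
Qed.

Lemma expm_scale0 xi : expm ((0 : R)%:C *: xi) = 1%:M.
Proof. by rewrite scale0r expm0. Qed.

Lemma flow0 xi z : act (expm ((0 : R)%:C *: xi)) z = z.
Proof. by rewrite expm_scale0 (act1 hact). Qed.

Lemma act_expmD xi s t z : (forall t, UC (expm (t%:C *: xi))) ->
  act (expm ((s + t)%:C *: xi)) z =
  act (expm (t%:C *: xi)) (act (expm (s%:C *: xi)) z).
Proof.
by move=> hxi; rewrite [s + t]addrC expmD; exact (actM hact z (hxi t) (hxi s)).
Qed.

Lemma flow_near0 xi i z : (forall t, UC (expm (t%:C *: xi))) -> dom i z ->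
  \forall s \near (0 : R), dom i (act (expm (s%:C *: xi)) z).
Proof. by move=> hxi iz; apply: (flow_near_dom hxi); rewrite flow0. Qed.

Lemma is_derive_chart_flow (W : normedModType R) (F : cspace R m -> W) xi i z :
  uC xi -> (forall t, UC (expm (t%:C *: xi))) -> dom i z ->
  differentiable F (phi i z) ->
  is_derive (0 : R) (1 : R) (fun t => F (phi i (act (expm (t%:C *: xi)) z)))
    ('d F (phi i z) (fund_vec act i xi z)).
Proof.
move=> hxi hU' iz dF.
have z0 : phi i (act (expm ((0 : R)%:C *: xi)) z) = phi i z.
  by rewrite flow0.
exact (is_derive_chain_at (fund_vecP hU hact hxi iz) z0 dF).
Qed.

(** Since exp((s + t) xi) z = exp(t xi) (exp(s xi) z), the velocity of the orbit
    at time t is the image of xi_Z(z) = 0 by the differential of exp(t xi). *)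
Lemma is_derive_flow0 xi i z t : uC xi -> (forall t, UC (expm (t%:C *: xi))) ->
  dom i z -> fund_vec act i xi z = 0 -> dom i (act (expm (t%:C *: xi)) z) ->
  is_derive t (1 : R) (fun s => phi i (act (expm (s%:C *: xi)) z)) 0.
Proof.
move=> hxi hUC iz fz it.
have dH := chart_map_differentiable (hUC t) iz it.
have := is_derive_chart_flow hxi hUC iz dH; rewrite fz linear0 => h.
have h' : is_derive (0 : R) (1 : R)
    (fun s => phi i (act (expm ((s + t)%:C *: xi)) z)) 0.
  apply: near_eq_is_derive h.
  apply: filterS (flow_near0 hUC iz) => s hs.
  exact (etrans (congr1 (fun w => phi i (act _ w)) (phiK hs))
    (congr1 (phi i) (esym (act_expmD _ _ _ hUC)))).
have hs : is_derive t (1 : R) (fun s => s - t) 1.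
  by rewrite -[X in is_derive _ _ _ X]subr0; apply: is_deriveB.
have e : t - t = 0 by rewrite subrr.
apply: is_derive_mx => a b; rewrite mxE.
have hab := is_derive_entry a b h'; rewrite mxE in hab.
have hc := @is_derive1_comp _ (fun s => phi i (act (expm ((s + t)%:C *: xi)) z) a b)
  (fun s => s - t) t 0 1.
rewrite e mul0r in hc.
apply: near_eq_is_derive (hc hab hs); near=> s; by rewrite /= subrK.
Unshelve. all: by end_near. Qed.

(** In a chart around z the orbit has zero velocity as long as it stays in the
    chart, so it is constant for small positive times; an arbitrary positive
    time is a multiple of a small one. *)
Lemma flow_fixed xi z : uC xi -> (forall t, UC (expm (t%:C *: xi))) ->
  (forall i, dom i z -> fund_vec act i xi z = 0) ->
  forall t, act (expm (t%:C *: xi)) z = z.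
Proof.
move=> hxi hUC fz; have [i iz] := cm_cover z.
have e0 := flow0 xi z.
have [e e_gt0 he] : exists2 e : R, 0 < e &
    forall t, `|t| < e -> dom i (act (expm (t%:C *: xi)) z).
  have /nbhs_ballP[e /= e0' he] := flow_near0 hUC iz; exists e => // t ht; apply: he.
  by rewrite /ball /= sub0r normrN.
have small t : 0 < t -> t < e -> act (expm (t%:C *: xi)) z = z.
  move=> t0 te.
  have hd s : 0 <= s <= t -> is_derive s (1 : R)
      (fun s => phi i (act (expm (s%:C *: xi)) z)) 0.
    move=> /andP[s0 st]; apply: (is_derive_flow0 hxi hUC iz (fz i iz)).
    by apply: he; rewrite ger0_norm //; exact: le_lt_trans te.
  have : phi i (act (expm (t%:C *: xi)) z) = phi i (act (expm ((0 : R)%:C *: xi)) z).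
    apply/matrixP => a b.
    have hab s : 0 <= s <= t -> is_derive s (1 : R)
        (fun s => phi i (act (expm (s%:C *: xi)) z) a b) 0.
      by move=> /hd /(is_derive_entry a b); rewrite mxE.
    have := @MVT _ (fun s => phi i (act (expm (s%:C *: xi)) z) a b) (fun=> 0) 0 t t0.
    case.
    - by move=> s; rewrite in_itv /= => /andP[s0 st]; apply: hab; rewrite !ltW.
    - apply: derivable_within_continuous => s.
      by rewrite in_itv /= => /hab[].
    - by move=> c _; rewrite mul0r => /eqP; rewrite subr_eq0 => /eqP.
  have it : dom i (act (expm (t%:C *: xi)) z) by apply: he; rewrite gtr0_norm.
  have i0 : dom i (act (expm ((0 : R)%:C *: xi)) z) by rewrite e0.
  by move=> /(phi_inj it i0) ->; exact: e0.
have pos t : 0 < t -> act (expm (t%:C *: xi)) z = z.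
  move=> t0.
  (* t is k + 1 times a time smaller than e *)
  have [k hk] : exists k : nat, t / e < k.+1%:R.
    exists (Num.truncn (t / e)); exact: truncnS_gt.
  have {}hk : t / k.+1%:R < e.
    by rewrite ltr_pdivrMr ?ltr0n // mulrC -ltr_pdivrMr.
  have hs := small _ (divr_gt0 t0 (ltr0Sn _ k)) hk.
  have hj (j : nat) : act (expm ((j%:R * (t / k.+1%:R))%:C *: xi)) z = z.
    elim: j => [|j IHj]; first by rewrite mul0r e0.
    have -> : j.+1%:R * (t / k.+1%:R) = j%:R * (t / k.+1%:R) + t / k.+1%:R.
      by rewrite -natr1 mulrDl mul1r.
    exact (etrans (act_expmD _ _ _ hUC) (etrans (congr1 (act _) IHj) hs)).
  have := hj k.+1; have -> // : k.+1%:R * (t / k.+1%:R) = t.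
  by rewrite mulrCA mulfV ?mulr1 // pnatr_eq0.
move=> t; have [t0|t0|->] := ltgtP t 0; last exact: e0.
  have nt : 0 < - t by rewrite oppr_gt0.
  exact (etrans (esym (congr1 (act (expm (t%:C *: xi))) (pos _ nt)))
    (etrans (esym (act_expmD (- t) t z hUC))
      (etrans (congr1 (fun r => act (expm (r%:C *: xi)) z) (addNr t)) e0))).
exact: pos.
Qed.

(** As g fixes z, exp(s Ad_g xi) z = g (exp(s xi) z), whose velocity at 0 is the
    image of xi_Z(z) = 0 by the differential of g. *)
Lemma fund_vec_Ad g xi i z : UC g -> UC (invmx g) -> g \in unitmx ->
  (forall t, UC (g *m expm (t%:C *: xi))) -> act g z = z -> uC xi ->
  (forall t, UC (expm (t%:C *: xi))) ->
  dom i z -> fund_vec act i xi z = 0 -> fund_vec act i (adj_action g xi) z = 0.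
Proof.
move=> hg hgi ug hge gz hxi hUC iz fz.
have igz : dom i (act g z) by rewrite gz.
have dH := chart_map_differentiable hg iz igz.
have := is_derive_chart_flow hxi hUC iz dH; rewrite fz linear0 => h.
have gzi : act (invmx g) z = z.
  by rewrite -{1}gz -(actM hact _ hgi hg) mulVmx // (act1 hact).
rewrite /fund_vec derive1E; apply: derive_val.
apply: near_eq_is_derive h.
apply: filterS (flow_near0 hUC iz) => s hs.
rewrite (phiK hs) /adj_action -(expm_conj _ _ ug).
by rewrite (actM hact _ (hge s) hgi) gzi (actM hact _ hg (hUC s)).
Qed.

End Stabilizers.

(** * Calculus on a real subspace of matrices *)

Section SubspaceCalculus.
Variables (R : realType) (n : nat) (V : set 'M[R[i]]_n).
Local Notation M := 'M[R[i]]_n.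
Hypothesis (hV : real_subspace V).
Implicit Types (A B E xi eta zeta : M) (F : M -> R) (t : R).

Lemma orthonormal_basis : exists d (e : 'I_d -> M), (forall a, V (e a)) /\
  forall A, V A -> A = \sum_a (ip (e a) A)%:C *: e a.
Proof.
have [k [e [_ Ve hp]]] := orthonormal_basis_nat hV.
exists k, (fun a : 'I_k => e a); split; first by move=> a; exact: Ve.
by move=> A VA; exact: hp.
Qed.

Lemma ip_basis d (e : 'I_d -> M)
    (he : forall A, V A -> A = \sum_a (ip (e a) A)%:C *: e a) E A :
   V A -> ip E A = \sum_a ip (e a) A * ip E (e a).
Proof.
by move=> VA; rewrite {1}(he A VA) ip_sumr; apply: eq_bigr => a _; rewrite ipZr.
Qed.

Definition coords d (e : 'I_d -> M) A : 'rV[R]_d := \row_a ip (e a) A.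

(** Reading F in coordinates makes the calculus on 'rV[R]_d available; the values
    of F outside V are arbitrary. *)
Definition differentiable_on F : Prop := exists d (e : 'I_d -> M) (g : 'rV[R]_d -> R),
  [/\ forall a, V (e a), forall A, V A -> A = \sum_a (ip (e a) A)%:C *: e a,
      forall s, differentiable g s & forall A, V A -> F A = g (coords e A)].

Lemma coords_line d (e : 'I_d -> M) zeta xi t :
  coords e (zeta + t%:C *: xi) = coords e zeta + t *: coords e xi.
Proof. by apply/rowP => a; rewrite !mxE ipDr ipZr. Qed.

Lemma dirderivE F d (e : 'I_d -> M) (g : 'rV[R]_d -> R) zeta xi :
  (forall A, V A -> F A = g (coords e A)) -> differentiable g (coords e zeta) ->
  V zeta -> V xi -> dirderiv F zeta xi = 'd g (coords e zeta) (coords e xi).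
Proof.
move=> hg dg Vz Vx; rewrite /dirderiv derive1E; apply: derive_val.
have := is_derive_line (coords e xi) dg.
rewrite (_ : (fun t : R => _) = (fun t => F (zeta + t%:C *: xi))) //.
apply/funext => t; rewrite hg ?coords_line //.
by apply: subspaceD => //; exact: subspaceZ.
Qed.

Lemma is_derive_curve F (c : R -> M) xi : differentiable_on F ->
  (forall t, V (c t)) -> is_mxderive c 0 xi ->
  is_derive (0 : R) (1 : R) (fun t => F (c t)) (dirderiv F (c 0) xi).
Proof.
move=> [d [e [g [Ve he dg hg]]]] Vc hc.
have Vx := subspace_mxderive hV Vc hc.
rewrite (dirderivE hg (dg _) (Vc 0) Vx).
have hcc : is_derive (0 : R) (1 : R) (fun t => coords e (c t)) (coords e xi).
  apply: is_derive_mx => a b; rewrite mxE; under eq_fun do rewrite mxE.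
  exact: hc.
have := is_derive_chain hcc (dg _).
rewrite (_ : (fun t : R => _) = (fun t => F (c t))) //.
by apply/funext => t; rewrite hg.
Qed.

Lemma dirderiv_linear F zeta t xi eta : differentiable_on F ->
  V zeta -> V xi -> V eta ->
  dirderiv F zeta (t%:C *: xi + eta) = t * dirderiv F zeta xi + dirderiv F zeta eta.
Proof.
move=> [d [e [g [Ve he dg hg]]]] Vz Vx Vy.
have Vs : V (t%:C *: xi + eta) by apply: subspaceD => //; exact: subspaceZ.
rewrite !(dirderivE hg (dg _)) //.
have -> : coords e (t%:C *: xi + eta) = t *: coords e xi + coords e eta.
  by rewrite addrC coords_line addrC.
by rewrite linearD linearZ.
Qed.

Lemma gradP F zeta : differentiable_on F -> V zeta ->
  V (grad V F zeta) /\ forall xi, V xi -> ip (grad V F zeta) xi = dirderiv F zeta xi.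
Proof.
move=> dF Vz; apply: sharpP => // t A B VA VB; exact: dirderiv_linear.
Qed.

Lemma smooth_differentiable_on F : smooth_fun_on V F -> differentiable_on F.
Proof.
move=> sF; have [d [e [Ve he]]] := orthonormal_basis.
exists d, e, (fun s => F (\sum_a (s 0 a)%:C *: e a)); split => //.
  by move=> s; have [h _] := sF d e Ve 1%N; exact: h.
move=> A VA; rewrite {1}(he A VA); congr F; apply: eq_bigr => a _.
by rewrite mxE.
Qed.

Lemma smooth_dirderiv_differentiable_on F eta : smooth_fun_on V F -> V eta ->
  differentiable_on (fun zeta => dirderiv F zeta eta).
Proof.
move=> sF Vy; have [d [e [Ve he]]] := orthonormal_basis.
pose g := fun s : 'rV[R]_d => F (\sum_a (s 0 a)%:C *: e a).
have hg A : V A -> F A = g (coords e A).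
  move=> VA; rewrite {1}(he A VA); congr F; apply: eq_bigr => a _.
  by rewrite mxE.
have [dg1 h2] := sF d e Ve 2%N.
exists d, e, (fun s => 'D_(coords e eta) g s); split => //.
  by move=> s; have [h _] := h2 (coords e eta); exact: h.
move=> A VA; rewrite (dirderivE hg) //; last exact: dg1.
by rewrite deriveE //; exact: dg1.
Qed.

Lemma is_mxderive_basis d (e : 'I_d -> M) (c : R -> M) (w : 'I_d -> R) t :
  (forall A, V A -> A = \sum_a (ip (e a) A)%:C *: e a) -> (forall t, V (c t)) ->
  (forall a, is_derive t (1 : R) (fun s => ip (e a) (c s)) (w a)) ->
  is_mxderive c t (\sum_a (w a)%:C *: e a).
Proof.
move=> he Vc hw E.
have -> : (fun s => ip E (c s)) = \sum_a (ip E (e a) *: (fun s => ip (e a) (c s))).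
  rewrite fct_sumE; apply/funext => s; rewrite (ip_basis he) //.
  by apply: eq_bigr => a _; rewrite mulrC.
have -> : ip E (\sum_a (w a)%:C *: e a) = \sum_a ip E (e a) *: w a.
  by rewrite ip_sumr; apply: eq_bigr => a _; rewrite ipZr mulrC.
by apply: is_derive_sum => a; exact: is_deriveZ.
Qed.

Lemma differentiable_row (W : normedModType R) d (h : 'I_d -> W -> R) v :
  (forall a, differentiable (h a) v) ->
  differentiable (fun w => \row_a h a w : 'rV[R]_d) v.
Proof.
move=> dh.
have -> : (fun w => \row_a h a w : 'rV[R]_d) =
    \sum_a (fun w => h a w *: (delta_mx 0 a : 'rV[R]_d)).
  rewrite fct_sumE; apply/funext => w; rewrite [LHS]row_sum_delta.
  by apply: eq_bigr => a _; rewrite mxE.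
by apply: differentiable_sum => a; exact: differentiableZl.
Qed.

(** The chain rule for F composed with a map c into V. Differentiability of c is
    only known through the functionals [ip E], so the rule is applied along
    lines, where c becomes a matrix curve. *)
Lemma diff_subspace_map (W : normedModType R) F (c : W -> M) v w B :
  differentiable_on F -> (forall u, V (c u)) ->
  (forall E, V E -> differentiable (fun u => ip E (c u)) v) ->
  (forall xi, V xi -> dirderiv F (c v) xi = ip B xi) -> V B ->
  'd (fun u => F (c u)) v w = 'd (fun u => ip B (c u)) v w.
Proof.
move=> dF Vc dc hB VB.
have [d [e [Ve he]]] := orthonormal_basis.
have dFc : differentiable (fun u => F (c u)) v.
  have [d' [e' [g [Ve' he' dg hg]]]] := dF.
  have -> : (fun u => F (c u)) = g \o (fun u => \row_a ip (e' a) (c u)).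
    by apply/funext => u; rewrite hg.
  apply: differentiable_comp; last exact: dg.
  by apply: differentiable_row => a; apply: dc; exact: Ve'.
have hl a := is_derive_line w (dc _ (Ve a)).
have hm := is_mxderive_basis he (fun t => Vc (v + t *: w)) hl.
have h1 := is_derive_curve dF (fun t => Vc (v + t *: w)) hm.
have Vm := subspace_mxderive hV (fun t => Vc (v + t *: w)) hm.
have h2 := is_derive_line w dFc.
rewrite (is_derive_unique h2 h1) scale0r addr0 hB //.
exact: is_derive_unique (hm B) (is_derive_line w (dc _ VB)).
Qed.

End SubspaceCalculus.

(** * Diagonalizing the adjoint action of a Hermitian matrix *)

Section Diagonalization.
Variables (R : realType) (n : nat) (beta : 'M[R[i]]_n).
Local Notation M := 'M[R[i]]_n.
Hypothesis (hbeta : ctr beta = beta).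
Implicit Types (A B xi eta : M) (s : seq R) (l : R).

Lemma herm_spectral : exists (P : M) (d : 'I_n -> R), P \in unitmx /\
  P *m beta = diag_mx (\row_i (d i)%:C) *m P.
Proof.
have hh : beta \is hermitianmx n false Num.conj.
  by apply/is_hermitianmxP; rewrite expr0 scale1r; exact: esym.
have /orthomx_spectralP h1 := hermitian_normalmx hh.
have /mxOverP h2 := hermitian_spectral_diag_real hh.
exists (spectralmx beta), (fun i => complex.Re (spectral_diag beta 0 i)).
have uP := spectral_unit beta; split => //.
have aux (P D B : M) : P \in unitmx -> B = invmx P *m D *m P -> P *m B = D *m P.
  by move=> u ->; rewrite !mulmxA mulmxV // mul1mx.
rewrite (aux _ _ _ uP h1); congr (diag_mx _ *m _).
by apply/rowP => i; rewrite mxE (RRe_real (h2 0 i)).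
Qed.

Fixpoint ad_prod s xi : M :=
  if s is l :: s' then ad_prod s' (lie_ad beta xi - l%:C *: xi) else xi.

(** In an orthonormal eigenbasis of beta, with eigenvalues d i, the operator
    ad_beta - l multiplies the entry (i, j) by d i - d j - l. *)
Lemma ad_prod_eq0 : exists s, uniq s /\ forall xi, ad_prod s xi = 0.
Proof.
have [P [d [uP hP]]] := herm_spectral.
pose c xi := P *m xi *m invmx P.
have hPi : beta *m invmx P = invmx P *m diag_mx (\row_i (d i)%:C).
  have := congr1 (fun X => invmx P *m X *m invmx P) hP.
  by rewrite mulKmx // mulmxA mulmxK.
have hc l xi i j : c (lie_ad beta xi - l%:C *: xi) i j =
    (d i - d j - l)%:C * c xi i j.
  have -> : c (lie_ad beta xi - l%:C *: xi) =
      diag_mx (\row_i (d i)%:C) *m c xi - c xi *m diag_mx (\row_i (d i)%:C)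
      - l%:C *: c xi.
    rewrite /c /lie_ad !mulmxBr !mulmxBl -scalemxAr -scalemxAl !mulmxA hP.
    by rewrite -[P *m xi *m beta *m _]mulmxA hPi !mulmxA.
  move: (c xi) => Y; rewrite mul_diag_mx mul_mx_diag !mxE !rmorphB /=.
  by rewrite [Y i j * _]mulrC -!mulrBl.
have hs s xi i j : c (ad_prod s xi) i j =
    (\prod_(l <- s) (d i - d j - l))%:C * c xi i j.
  elim: s xi => [|l s IHs] xi; first by rewrite big_nil mul1r.
  by rewrite big_cons /= IHs hc mulrA -rmorphM [X in X%:C * _]mulrC.
exists (undup [seq d i - d j | i <- enum 'I_n, j <- enum 'I_n]).
split; first exact: undup_uniq.
move=> xi; set s := undup _.
have c0 : c (ad_prod s xi) = 0.
  apply/matrixP => i j; rewrite hs [RHS]mxE.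
  have hin : d i - d j \in s.
    by rewrite mem_undup; apply: allpairs_f; rewrite mem_enum.
  have -> : \prod_(l <- s) (d i - d j - l) = 0.
    by rewrite (big_rem _ hin) /= subrr mul0r.
  by rewrite rmorph0 mul0r.
have <- : invmx P *m c (ad_prod s xi) *m P = ad_prod s xi.
  by rewrite /c !mulmxA mulVmx // mul1mx mulmxKV.
by rewrite c0 mulmx0 mul0mx.
Qed.

(** By induction ad_beta xi - l xi is a sum of eigenvectors a y with y != l in s.
    Subtracting the sum of (y - l)^-1 a y from xi leaves an eigenvector for l. *)
Lemma ad_eigen_decomp (V : set M) s xi : real_subspace V ->
  (forall eta, V eta -> V (lie_ad beta eta)) -> uniq s -> V xi ->
  ad_prod s xi = 0 ->
  exists a : R -> M, xi = \sum_(l <- s) a l /\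
    forall l, l \in s -> V (a l) /\ lie_ad beta (a l) = l%:C *: a l.
Proof.
move=> hV had; elim: s xi => [|l s IHs] xi /=.
  by move=> _ _ ->; exists (fun=> 0); rewrite big_nil.
move=> /andP[ls us] Vxi h0.
have Veta : V (lie_ad beta xi - l%:C *: xi).
  by apply: subspaceB => //; [exact: had | exact: subspaceZ].
have [a [ha Va]] := IHs _ us Veta h0.
pose xi' := xi - \sum_(x <- s) ((x - l)^-1)%:C *: a x.
exists (fun x => if x == l then xi' else ((x - l)^-1)%:C *: a x); split.
  rewrite big_cons eqxx (_ : \sum_(x <- s) _ = \sum_(x <- s) ((x - l)^-1)%:C *: a x).
    by rewrite subrK.
  rewrite !big_seq; apply: eq_bigr => x xs.
  by case: eqP => // xl; move: ls; rewrite -xl xs.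
move=> x; rewrite inE; case: (eqVneq x l) => [-> _|xl /= xs]; last first.
  have [Vx hx] := Va x xs; split; first exact: subspaceZ.
  by rewrite lie_adZr hx !scalerA mulrC.
split.
  apply: subspaceB => //; rewrite big_seq; apply: subspace_sum => // x' xs.
  by apply: subspaceZ => //; case: (Va _ xs).
have hsum : lie_ad beta (\sum_(x <- s) ((x - l)^-1)%:C *: a x) =
    \sum_(x <- s) ((x - l)^-1)%:C *: (x%:C *: a x).
  rewrite (big_morph (lie_ad beta) (lie_adDr beta) (lie_ad0r beta)) !big_seq.
  by apply: eq_bigr => y ys; rewrite lie_adZr; case: (Va _ ys) => _ ->.
apply/eqP; rewrite -subr_eq0 /xi' lie_adDr lie_adNr hsum scalerBr opprB addrA.
rewrite addrAC [lie_ad beta xi - _ - _]addrAC ha.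
rewrite scaler_sumr -sumrB -big_split /= big_seq big1 // => y ys.
have yl : y - l != 0.
  by rewrite subr_eq0; apply: contraTneq ys => ->.
rewrite !scalerA -[X in X - _ + _]scale1r -scalerBl -scalerDl.
have -> : (1 : R[i]) - ((y - l)^-1)%:C * y%:C + l%:C * ((y - l)^-1)%:C = 0.
  have e : 1 - (y - l)^-1 * y + l * (y - l)^-1 = 0 :> R.
    have := mulVf yl; rewrite mulrBr => /eqP; rewrite subr_eq => /eqP ->.
    by rewrite [l * _]mulrC opprD addrA subrr sub0r addNr.
  by have := congr1 (fun r : R => r%:C) e; rewrite /= rmorphD rmorphB !rmorphM.
by rewrite scale0r.
Qed.

Lemma ip_eigen_orth A B l1 l2 : lie_ad beta A = l1%:C *: A ->
  lie_ad beta B = l2%:C *: B -> l1 != l2 -> ip A B = 0.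
Proof.
move=> hA hB hl; have := ip_ad_herm A B hbeta.
rewrite hA hB ipZl ipZr => /eqP; rewrite -subr_eq0 -mulrBl mulf_eq0.
by rewrite subr_eq0 (negPf hl) /= => /eqP.
Qed.

End Diagonalization.

(** * The stabilizer algebra at a critical point *)

Section Main.
Variables (R : realType) (n m : nat) (Z : complexManifold R m).
Variables (om : kahlerForm Z) (U G : set 'M[R[i]]_n) (act : 'M[R[i]]_n -> Z -> Z).
Variables (mu : Z -> 'M[R[i]]_n -> R) (f : 'M[R[i]]_n -> R) (z : Z).
Hypotheses (hU : compact_connected_unitary_group U) (hG : real_compatible U G).
Hypotheses (hact : holomorphic_action U act) (hmu : momentum_map om U act mu).
Hypotheses (fsmooth : smooth_fun_on (palg U G) f)
  (finv : Ad_invariant (Kgrp U G) (palg U G) f)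
  (fconvex : strictly_convex (palg U G) f)
  (zcrit : critical_point (fun x => f (gradient_map U G mu x)) z).
Local Notation M := 'M[R[i]]_n.
Local Notation k := (lie (Kgrp U G)).
Local Notation p := (palg U G).
Local Notation mup := (gradient_map U G mu).
Local Notation beta := (grad p f (mup z)).
Local Notation gz := (lie_stab G act z).
Local Notation fv := (fund_vec act).
Implicit Types (A B E xi eta kap q : M) (t : R) (i : cm_index Z).

Let hUg : mx_subgroup U := U_group hU.
Let hp : real_subspace p := p_subspace hG.
Let hk : real_subspace k := k_subspace hG.

Lemma p_lieU q : p q -> lie U ('i *: q).
Proof. by move=> /p_itimes /itimes_lieU. Qed.

Lemma gradient_mapP x : p (mup x) /\ forall xi, p xi -> ip (mup x) xi = mu x ('i *: xi).
Proof.
rewrite /gradient_map; set l := fun xi => _.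
have [hl hl'] : itimes (lie U) (sharp (itimes (lie U)) l) /\
    forall A, itimes (lie U) A -> ip (sharp (itimes (lie U)) l) A = l A.
  apply: sharpP; first exact: itimes_subspace (lieU_subspace hU).
  move=> t A B hA hB; rewrite /l scalerDr scalerA mulrC -scalerA.
  by case: hmu => h _ _ _; apply: h; exact: itimes_lieU.
have [hP hP'] := orthprojP (sharp (itimes (lie U)) l) hp.
split => // xi pxi; have := hP' xi pxi; rewrite ipBl => /eqP.
by rewrite subr_eq0 => /eqP <-; apply: hl'; exact (p_itimes pxi).
Qed.

Let px : p (mup z) := proj1 (gradient_mapP z).

Lemma gradient_map_mu x xi : p xi -> ip (mup x) xi = mu x ('i *: xi).
Proof. exact: (proj2 (gradient_mapP x)). Qed.

Lemma mu_differentiable xi i : lie U xi -> dom i z ->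
  differentiable (fun v => mu (psi i v) xi) (phi i z).
Proof.
move=> hxi iz; case: hmu => _ h _ _; have [h' _] := h xi i hxi 1%N.
by apply: h'; exists z.
Qed.

Lemma f_differentiable_on : differentiable_on p f.
Proof. exact: smooth_differentiable_on. Qed.

Lemma grad_in_p : p beta.
Proof. by have [] := gradP hp f_differentiable_on px. Qed.

Lemma ip_grad xi : p xi -> ip beta xi = dirderiv f (mup z) xi.
Proof. by have [_] := gradP hp f_differentiable_on px; apply. Qed.

Lemma UC_lieG xi : lie G xi -> forall t, complexified_group U (expm (t%:C *: xi)).
Proof. by move=> hxi t; apply: (G_UC hG); exact: hxi. Qed.

Lemma uC_lieG xi : lie G xi -> complexified_lie U xi.
Proof. exact: lieG_complexified. Qed.

Lemma is_mxderive_Ad_inv kap A :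
  is_mxderive (fun t => adj_action (invmx (expm (t%:C *: kap))) A) 0 (- lie_ad kap A).
Proof.
rewrite -lie_adNl.
have -> : (fun t => adj_action (invmx (expm (t%:C *: kap))) A) =
    (fun t => adj_action (expm (t%:C *: - kap)) A).
  by apply/funext => t; rewrite expm_inv scalerN -scaleNr rmorphN.
exact: is_mxderive_Ad.
Qed.

Lemma p_Ad_inv kap A t : k kap -> p A -> p (adj_action (invmx (expm (t%:C *: kap))) A).
Proof. by move=> kk pA; rewrite expm_inv; exact (p_Ad hU hG (kk (- t)) pA). Qed.

(** Derivative at t = 0 of mu(exp(t kap) z)(i eta), computed once by the defining
    property of the momentum map and once by its equivariance. *)
Lemma moment_bracket i kap eta : dom i z -> k kap -> p eta ->
  om i (phi i z) (fv i kap z) (cJ (fv i eta z)) = ip (lie_ad kap (mup z)) eta.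
Proof.
move=> iz kk pe; have kG := k_lieG kk.
have ie := p_lieU pe.
have h1 := is_derive_chart_flow hUg hact (uC_lieG kG) (UC_lieG kG) iz
  (mu_differentiable ie iz).
have h2 : is_derive (0 : R) (1 : R)
    (fun t => mu (psi i (phi i (act (expm (t%:C *: kap)) z))) ('i *: eta))
    (ip (mup z) (- lie_ad kap eta)).
  apply: near_eq_is_derive (is_mxderive_Ad_inv kap eta (mup z)).
  apply: filterS (flow_near0 hact (UC_lieG kG) iz) => t ht.
  rewrite (phiK ht); case: hmu => _ _ _ ->; last exact: ie.
    rewrite adj_actionZ; exact (gradient_map_mu z (p_Ad_inv t kk pe)).
  by case: (kk t).
have := is_derive_unique h1 h2.
case: hmu => _ _ -> // _; rewrite (fund_veci hUg hact (uC_lieG (p_lieG pe)) iz).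
by move=> ->; rewrite (ip_ad_skew _ _ (k_skew hU kk)) ipNr.
Qed.

Lemma adj_action_cancel g A B t : g \in unitmx ->
  adj_action g (A + t%:C *: adj_action (invmx g) B) = adj_action g A + t%:C *: B.
Proof.
move=> ug; rewrite {1}/adj_action mulmxDr mulmxDl -scalemxAr -scalemxAl.
congr (_ + _ *: _); rewrite /adj_action invmxK !mulmxA mulmxV // mul1mx.
by rewrite mulmxK.
Qed.

(** Invariance of f gives df at Ad_g x applied to eta as <beta, Ad_(g^-1) eta>;
    this is its derivative at t = 0 along g = exp(t kap). *)
Lemma hess_bracket kap eta : k kap -> p eta ->
  hess f (mup z) (lie_ad kap (mup z)) eta = ip (lie_ad kap beta) eta.
Proof.
move=> kk pe.
have dF := smooth_dirderiv_differentiable_on hp fsmooth pe.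
pose c t := adj_action (expm (t%:C *: kap)) (mup z).
have pc t : p (c t) by exact: (p_Ad hU hG (kk t) px).
have h1 := is_derive_curve hp dF pc (is_mxderive_Ad kap (mup z)).
have c0 : c 0 = mup z.
  by rewrite /c /adj_action expm_scale0 invmx1 mul1mx mulmx1.
rewrite c0 in h1.
have hd t : dirderiv f (c t) eta =
    ip beta (adj_action (invmx (expm (t%:C *: kap))) eta).
  rewrite (ip_grad (p_Ad_inv t kk pe)) /dirderiv.
  congr (derive1 _ 0); apply/funext => s.
  rewrite -[RHS](finv (kk t)); last first.
    by apply: (subspaceD hp px); apply: (subspaceZ _ hp); exact (p_Ad_inv t kk pe).
  by rewrite (adj_action_cancel _ _ _ (expm_unit kap t)).
have h2 : is_derive (0 : R) (1 : R) (fun t => dirderiv f (c t) eta)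
    (ip beta (- lie_ad kap eta)).
  under eq_fun do rewrite hd; exact: is_mxderive_Ad_inv.
have := is_derive_unique h1 h2; rewrite /hess => ->.
by rewrite (ip_ad_skew _ _ (k_skew hU kk)) ipNr.
Qed.

Lemma kahler0l i v : dom i z -> om i (phi i z) 0 v = 0.
Proof.
move=> iz; have hx : cdom i (phi i z) by exists z.
have := @omega_linear _ _ _ om i _ 1 0 0 v hx.
by rewrite scaler0 addr0 mul1r => /eqP; rewrite -subr_eq subrr eq_sym => /eqP.
Qed.

Lemma kahlerNl i u v : dom i z -> om i (phi i z) (- u) v = - om i (phi i z) u v.
Proof.
move=> iz; have hx : cdom i (phi i z) by exists z.
have := @omega_linear _ _ _ om i _ (-1) u 0 v hx.
by rewrite addr0 scaleN1r mulN1r kahler0l // addr0.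
Qed.

Lemma kahler_norm_eq0 i v : dom i z -> om i (phi i z) v (cJ v) = 0 -> v = 0.
Proof.
move=> iz h; apply/eqP; apply: contraT => v0.
have hx : cdom i (phi i z) by exists z.
by have := omega_pos om hx v0; rewrite h ltxx.
Qed.

Lemma kahler_norm_ge0 i v : dom i z -> 0 <= om i (phi i z) v (cJ v).
Proof.
move=> iz; have [->|v0] := eqVneq v 0; first by rewrite kahler0l.
have hx : cdom i (phi i z) by exists z.
exact: ltW (omega_pos om hx v0).
Qed.

(** The differential at z of f composed with the gradient map is
    v |-> omega(v, (i beta)_Z), and (i beta)_Z = J beta_Z; take v = beta_Z. *)
Lemma fund_vec_grad i : dom i z -> fv i beta z = 0.
Proof.
move=> iz; apply: (kahler_norm_eq0 iz).
have pb := grad_in_p; have ib := p_lieU pb.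
have -> : cJ (fv i beta z) = fv i ('i *: beta) z.
  by rewrite (fund_veci hUg hact (uC_lieG (p_lieG pb)) iz).
set w := fv i beta z; case: hmu => _ _ hd _; rewrite -(hd _ _ _ w ib iz).
have dc E : p E -> differentiable (fun u => ip E (mup (psi i u))) (phi i z).
  move=> pE;
  have -> : (fun u => ip E (mup (psi i u))) =
      (fun u => mu (psi i u) ('i *: E)).
    by apply/funext => u; rewrite ipC gradient_map_mu.
  exact (mu_differentiable (p_lieU pE) iz).
have hB xi : p xi -> dirderiv f (mup (psi i (phi i z))) xi = ip beta xi.
  by move=> pxi; rewrite phiK // ip_grad.
have := diff_subspace_map hp w f_differentiable_on
  (fun u => proj1 (gradient_mapP (psi i u))) dc hB pb.
have -> : (fun u => ip beta (mup (psi i u))) = (fun u => mu (psi i u) ('i *: beta)).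
  by apply/funext => u; rewrite ipC gradient_map_mu.
by move=> <-; exact: zcrit.
Qed.

Lemma fund_vec0 i : dom i z -> fv i 0 z = 0.
Proof.
move=> iz; have u0 : complexified_lie U 0.
  by apply: lieU_complexified => //; exact: lie0.
have := fund_vecD hUg hact (-1) u0 u0 iz.
by rewrite scaler0 addr0 scaleN1r addNr.
Qed.

Lemma fund_vec_stab_split i kap q : dom i z -> lie G kap -> lie G q ->
  fv i (kap + q) z = 0 -> fv i kap z = - fv i q z.
Proof.
move=> iz lk lq h.
have := fund_vecD hUg hact 1 (uC_lieG lk) (uC_lieG lq) iz.
rewrite scale1r scale1r h => /eqP; rewrite eq_sym addr_eq0.
by move=> /eqP.
Qed.

Lemma stab_subspace : real_subspace gz.
Proof.
have hGs := lieG_subspace hG.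
split; first by split; [exact: subspace0 | exact: fund_vec0].
move=> t A B [lA hA] [lB hB]; split.
  exact (proj2 hGs t A B lA lB).
move=> i iz; rewrite (fund_vecD hUg hact _ (uC_lieG lA) (uC_lieG lB) iz).
by rewrite hA // hB // scaler0 addr0.
Qed.

Lemma stab_grad : gz beta.
Proof. by split; [exact (p_lieG grad_in_p) | exact fund_vec_grad]. Qed.

Lemma stab_ad_grad xi : gz xi -> gz (lie_ad beta xi).
Proof.
move=> [lx hx]; have lb := p_lieG grad_in_p; have hGg := G_group hG.
apply: (subspace_mxderive stab_subspace _ (is_mxderive_Ad beta xi)) => t.
split; first exact: lie_Ad hGg (lb t) lx.
move=> i iz; have [_ GM GV] := hGg; have [ug Gi] := GV _ (lb t).
apply: (fund_vec_Ad hUg hact) (uC_lieG lx) (UC_lieG lx) iz (hx i iz).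
- exact: (G_UC hG (lb t)).
- exact: (G_UC hG Gi).
- exact: ug.
- by move=> s; exact: (G_UC hG (GM _ _ (lb t) (lx s))).
- exact: (flow_fixed hUg hact (uC_lieG lb) (UC_lieG lb) fund_vec_grad t).
Qed.

Lemma hess_eq0 y : p y -> hess f (mup z) y y <= 0 -> y = 0.
Proof.
move=> py h; apply/eqP; apply: contraT => y0.
by have := fconvex px py y0; rewrite ltNge h.
Qed.

Lemma hess0l eta : p eta -> hess f (mup z) 0 eta = 0.
Proof.
move=> pe; have k0 : k 0 by exact: subspace0.
have ad0 A : lie_ad 0 A = 0 by rewrite lie_adC lie_ad0r oppr0.
by have := hess_bracket k0 pe; rewrite !ad0 ip0l.
Qed.

(** [hess_bracket] determines [kap, beta], an element of p, from [kap, x]. *)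
Lemma k_centralizer kap : k kap -> lie_ad kap (mup z) = 0 -> lie_ad kap beta = 0.
Proof.
move=> kk h; have pb : p (lie_ad kap beta) := kp_bracket hU hG kk grad_in_p.
by apply: ip_eq0; rewrite -hess_bracket // h hess0l.
Qed.

Lemma kz_commutes kap : k kap -> gz kap -> lie_ad kap (mup z) = 0.
Proof.
move=> kk [_ h]; have [i iz] := cm_cover z.
have py : p (lie_ad kap (mup z)) := kp_bracket hU hG kk px.
by apply: ip_eq0; rewrite -(moment_bracket iz kk py) h // kahler0l.
Qed.

(** With Y = [q, x] in k, <Y, Y> = <[Y, x], q>, which is omega(Y_Z, J q_Z) = 0. *)
Lemma pz_commutes q : p q -> gz q -> lie_ad q (mup z) = 0.
Proof.
move=> pq [_ h]; have [i iz] := cm_cover z.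
have ky : k (lie_ad q (mup z)) := pp_bracket hU hG pq px.
have swap Y : ctr Y = - Y -> ip (lie_ad q (mup z)) Y = ip (lie_ad Y (mup z)) q.
  move=> hY; rewrite (ip_ad_herm _ _ (p_herm hU pq)) (ip_ad_skew _ _ hY).
  by rewrite -ipNr -lie_adC.
apply: ip_eq0; rewrite (swap _ (k_skew hU ky)) -(moment_bracket iz ky pq) h //.
have -> : cJ (0 : cspace R m) = 0 by rewrite /cJ !linear0 row_mx0.
have hx : cdom i (phi i z) by exists z.
by rewrite omega_skew // kahler0l // !oppr0.
Qed.

Lemma kz_grad_commutes kap : k kap -> gz kap -> lie_ad beta kap = 0.
Proof.
move=> kk gk; rewrite lie_adC k_centralizer ?oppr0 //; exact: kz_commutes.
Qed.

(** The bracket Y = [q, beta] lies in k and commutes with x, as q and beta do,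
    hence commutes with beta; so <Y, Y> = <q, [Y, beta]> = 0. *)
Lemma pz_grad_commutes q : p q -> gz q -> lie_ad beta q = 0.
Proof.
move=> pq gq.
have kb : k (lie_ad q beta) := pp_bracket hU hG pq grad_in_p.
have h0 : lie_ad (lie_ad q beta) (mup z) = 0 :=
  lie_ad_centralizer (pz_commutes pq gq) (pz_commutes grad_in_p stab_grad).
have h1 := k_centralizer kb h0.
have swap Y : ip (lie_ad q beta) Y = ip q (lie_ad Y beta).
  by rewrite lie_adC ipNl (ip_ad_herm _ _ (p_herm hU grad_in_p)) -ipNr -lie_adC.
have h2 : lie_ad q beta = 0 by apply: ip_eq0; rewrite swap h1 ip0r.
by rewrite lie_adC h2 oppr0.
Qed.

(** ad_beta exchanges k and p. *)
Lemma eigen_split l kap q : k kap -> p q ->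
  lie_ad beta (kap + q) = l%:C *: (kap + q) ->
  lie_ad beta kap = l%:C *: q /\ lie_ad beta q = l%:C *: kap.
Proof.
move=> kk pq; rewrite lie_adDr scalerDr => h.
have h' : lie_ad beta kap - l%:C *: q = l%:C *: kap - lie_ad beta q.
  by apply/eqP; rewrite subr_eq addrAC eq_sym subr_eq eq_sym h.
have pe : p (lie_ad beta kap - l%:C *: q).
  apply: subspaceB => //; last exact: subspaceZ.
  exact: (pk_bracket hU hG grad_in_p kk).
have ke : k (l%:C *: kap - lie_ad beta q).
  exact (subspaceB hk (subspaceZ l hk kk) (pp_bracket hU hG grad_in_p pq)).
have e0 : lie_ad beta kap - l%:C *: q = 0.
  by apply: skew_herm_eq0; [rewrite h'; exact (k_skew hU ke) | exact (p_herm hU pe)].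
split; first exact: subr0_eq.
by apply/esym/subr0_eq; rewrite -h'.
Qed.

(** [hess_bracket] gives - l <q, y> with y = [kap, x], and [moment_bracket] gives
    <y, q> = omega(kap_Z, J q_Z) with kap_Z = - q_Z. *)
Lemma eigen_hess l kap q i : dom i z -> k kap -> p q -> gz (kap + q) ->
  lie_ad beta (kap + q) = l%:C *: (kap + q) ->
  hess f (mup z) (lie_ad kap (mup z)) (lie_ad kap (mup z)) =
  l * om i (phi i z) (fv i q z) (cJ (fv i q z)).
Proof.
move=> iz kk pq [_ gx] hl; have [h1 h2] := eigen_split kk pq hl.
have py : p (lie_ad kap (mup z)) := kp_bracket hU hG kk px.
rewrite hess_bracket // lie_adC h1 ipNl ipZl [ip q _]ipC.
rewrite -(moment_bracket iz kk pq) -mulrN -kahlerNl //; congr (_ * om _ _ _ _).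
by rewrite (fund_vec_stab_split iz (k_lieG kk) (p_lieG pq) (gx i iz)) opprK.
Qed.

(** [eigen_hess] makes the Hessian nonpositive at y = [kap, x], so y = 0 and kap
    commutes with beta; as l != 0, both components vanish. *)
Lemma negative_eigen l xi : l < 0 -> gz xi -> lie_ad beta xi = l%:C *: xi -> xi = 0.
Proof.
move=> l0 gx; have [lx _] := gx; move: lx.
rewrite (lieG_decomp hG) => -[kap [q [kk pq exi]]]; move: gx; rewrite exi => gx hl.
have [i iz] := cm_cover z.
have py : p (lie_ad kap (mup z)) := kp_bracket hU hG kk px.
have y0 : lie_ad kap (mup z) = 0.
  apply: hess_eq0 => //; rewrite (eigen_hess iz kk pq gx hl).
  by rewrite mulr_le0_ge0 ?kahler_norm_ge0 // ltW.
have lC0 : l%:C != 0 :> R[i] by rewrite fmorph_eq0 lt_eqF.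
have [h1 h2] := eigen_split kk pq hl.
have q0 : q = 0.
  have := k_centralizer kk y0; rewrite lie_adC h1 => /eqP.
  by rewrite oppr_eq0 scaler_eq0 (negPf lC0) => /eqP.
have k0 : kap = 0.
  move: h2; rewrite q0 lie_ad0r => /esym /eqP.
  by rewrite scaler_eq0 (negPf lC0) => /eqP.
by rewrite q0 k0 addr0.
Qed.

(** [eigen_hess] gives [kap, x] = 0; then [moment_bracket] shows that q_Z has
    norm 0. *)
Lemma zero_eigen kap q : k kap -> p q -> gz (kap + q) ->
  lie_ad beta (kap + q) = 0%:C *: (kap + q) -> gz kap /\ gz q.
Proof.
move=> kk pq gx hl.
have gq : gz q.
  split; first exact (p_lieG pq).
  move=> i iz; apply: (kahler_norm_eq0 iz).
  have py : p (lie_ad kap (mup z)) := kp_bracket hU hG kk px.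
  have y0 : lie_ad kap (mup z) = 0.
    by apply: hess_eq0 => //; rewrite (eigen_hess iz kk pq gx hl) mul0r.
  have := moment_bracket iz kk pq; rewrite y0 ip0l => h.
  have e := fund_vec_stab_split iz (k_lieG kk) (p_lieG pq) (proj2 gx i iz).
  by move: h; rewrite e (kahlerNl _ _ iz) => /eqP; rewrite oppr_eq0 => /eqP.
have gk := subspaceB stab_subspace gx gq; rewrite addrK in gk.
exact (conj gk gq).
Qed.

Lemma eigenspace_subspace l :
  real_subspace [set xi | gz xi /\ lie_ad beta xi = l%:C *: xi].
Proof.
have hz := stab_subspace; split.
  by split; [exact: subspace0 | rewrite lie_ad0r scaler0].
move=> t A B [gA hA] [gB hB]; split.
  exact (proj2 hz t A B gA gB).
by rewrite lie_adDr lie_adZr hA hB scalerDr !scalerA mulrC.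
Qed.

(** Eigenvectors of distinct eigenvalues are orthogonal because ad_beta is
    symmetric, whence independence. *)
Lemma eigen_direct_sum : direct_sum [set l : R | 0 <= l] gz
  (fun l => [set xi | gz xi /\ lie_ad beta xi = l%:C *: xi]).
Proof.
have hb := p_herm hU grad_in_p; have hz := stab_subspace.
split => //; first by move=> l _; exact: eigenspace_subspace.
  move=> xi; split=> [gx|[s [a [us ha ->]]]]; last first.
    by rewrite big_seq; apply: subspace_sum => // l ls; have [_ []] := ha _ ls.
  have [s [us hs]] := ad_prod_eq0 hb.
  have [a [-> ha]] := ad_eigen_decomp hz stab_ad_grad us gx (hs xi).
  exists [seq l <- s | 0 <= l], a; split; first exact: filter_uniq.
    by move=> l; rewrite mem_filter => /andP[l0 ls]; exact (conj l0 (ha l ls)).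
  have neg : \sum_(l <- s | ~~ (0 <= l)) a l = 0.
    rewrite big_seq_cond big1 // => l /andP[ls]; rewrite -ltNge => l0.
    by have [gl hl] := ha _ ls; exact (negative_eigen l0 gl hl).
  by rewrite big_filter (bigID (fun l => 0 <= l)) /= neg addr0.
move=> s a us ha h l ls; apply: ip_eq0.
have := congr1 (ip (a l)) h; rewrite ip0r ip_sumr (bigD1_seq l) //=.
rewrite big_seq_cond big1 ?addr0 // => x /andP[xs xl].
have [_ [_ hl]] := ha _ ls; have [_ [_ hx]] := ha _ xs.
by apply: (ip_eigen_orth hb hl hx); rewrite eq_sym.
Qed.

Lemma zero_direct_sum :
  direct_sum2 [set xi | gz xi /\ lie_ad beta xi = 0%:C *: xi]
    (gz `&` k) (gz `&` p).
Proof.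
have hz := stab_subspace.
apply: direct_sum2I; first exact: eigenspace_subspace.
- exact: subspaceI.
- exact: subspaceI.
- move=> xi; split=> [[gx hx]|[kap [q [[gk kk] [gq pq] ->]]]].
    have [lx _] := gx; move: lx; rewrite (lieG_decomp hG) => -[kap [q [kk pq exi]]].
    rewrite exi in gx hx; have [gk gq] := zero_eigen kk pq gx hx.
    by exists kap, q.
  split; first exact (subspaceD hz gk gq).
  by rewrite lie_adDr kz_grad_commutes // pz_grad_commutes // scale0r addr0.
move=> kap q [_ kk] [_ pq] h.
have e : kap = - q by apply/eqP; rewrite -addr_eq0 h.
have k0 : kap = 0.
  apply: skew_herm_eq0; first exact: (k_skew hU kk).
  by rewrite e ctrN (p_herm hU pq).
by split => //; move: h; rewrite k0 add0r.
Qed.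

End Main.

Unset Implicit Arguments.

Theorem theoremA (R : realType) (n m : nat)
  (Z : complexManifold R m) (om : kahlerForm Z)
  (Zcompact : compact [set: Z]) (Zconnected : connected [set: Z])
  (U : set 'M[R[i]]_n) (hU : compact_connected_unitary_group U)
  (act : 'M[R[i]]_n -> Z -> Z)
  (hact : kahler_action om U act) (hactC : holomorphic_action U act)
  (mu : Z -> 'M[R[i]]_n -> R) (hmu : momentum_map om U act mu)
  (G : set 'M[R[i]]_n) (hG : real_compatible U G)
  (f : 'M[R[i]]_n -> R)
  (fsmooth : smooth_fun_on (palg U G) f)
  (finv : Ad_invariant (Kgrp U G) (palg U G) f)
  (fconvex : strictly_convex (palg U G) f)
  (z : Z)
  (zcrit : critical_point (fun x => f (gradient_map U G mu x)) z)
  (hF : exists F : 'M[R[i]]_n -> R,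
    [/\ smooth_fun_on (itimes (lie U)) F,
        strictly_convex (itimes (lie U)) F,
        Ad_invariant U (itimes (lie U)) F,
        (forall xi, palg U G xi -> F xi = f xi) &
        kp_compatible U G F (gradient_map U G mu z)]) :
  let beta := grad (palg U G) f (gradient_map U G mu z) in
  let gz := lie_stab G act z in
  let glam (lambda : R) :=
    [set xi | gz xi /\ lie_ad beta xi = lambda%:C *: xi] in
  direct_sum [set lambda : R | 0 <= lambda] gz glam /\
  direct_sum2 (glam 0) (gz `&` lie (Kgrp U G)) (gz `&` palg U G).
Proof.
split.
  exact (eigen_direct_sum hU hG hactC hmu fsmooth finv fconvex zcrit).
exact (zero_direct_sum hU hG hactC hmu fsmooth finv fconvex zcrit).
Qed.
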